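(* Let $w,z\in\mathbb{C}$ be such that neither $w$ nor $z$ is a non-positive integer and $w+z-\tfrac12\notin\mathbb{Z}$. Then the series below converges and $$\frac{1}{\sqrt{2\pi}}\,\frac{2^{w+z}\,\Gamma(w)\,\Gamma(z)}{1-\cot(\pi w)\cot(\pi z)}=\sum_{n=0}^{\infty}\frac{\Gamma\!\left(w+z-n-\tfrac12\right)}{2^n\,n!}\,\left(w-z-n+\tfrac12\right)_{2n},$$ where the factor $\dfrac{1}{1-\cot(\pi w)\cot(\pi z)}$ is to be read as $-\dfrac{\sin(\pi w)\sin(\pi z)}{\cos(\pi(w+z))}$ (the two expressions agree whenever $w,z\notin\mathbb{Z}$).
   Context: $\Gamma$ denotes Euler's gamma function. $(a)_k$ denotes the Pochhammer symbol (rising factorial): $(a)_0=1$ and $(a)_k=a(a+1)\cdots(a+k-1)$ for integers $k\ge 1$. *)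

(* Defs.v *)
From Stdlib Require Import Reals Arith.
From Coquelicot Require Import Coquelicot.
Open Scope C_scope.

Notation CC := Coquelicot.Complex.C.

Definition Cexp (z : CC) : CC :=
  (exp (Re z) * cos (Im z), exp (Re z) * sin (Im z))%R.

Definition Csin (z : CC) : CC := (Cexp (Ci * z) - Cexp (- (Ci * z))) / (2 * Ci).
Definition Ccos (z : CC) : CC := (Cexp (Ci * z) + Cexp (- (Ci * z))) / 2.

Definition Cpowr (a : R) (s : CC) : CC := Cexp (s * RtoC (ln a)).

Fixpoint poch (a : CC) (k : nat) : CC :=
  match k with
  | O => 1
  | S k' => poch a k' * (a + RtoC (INR k'))
  end.

Definition gauss_term (z : CC) (n : nat) : CC :=
  RtoC (INR (Factorial.fact n)) * Cpowr (INR n) z / poch z (S n).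

(* Euler's Gamma function on C \ {0,-1,-2,...}, via Gauss' limit formula
   Gamma(z) = lim_{n->oo} n! n^z / (z(z+1)...(z+n)). *)
Definition CGamma (z : CC) : CC :=
  @lim (CompleteNormedModule.CompleteSpace C_AbsRing C_CompleteNormedModule) (filtermap (gauss_term z) eventually).

(* Main.v *)
Require Import Defs.
From Stdlib Require Import Reals Arith Lra Lia Psatz.
From Coquelicot Require Import Coquelicot.
Open Scope C_scope.

(** With [s = w + z - 1/2], [a = w - z + 1/2] and [c = 1 - s], the [n]-th term is
    [Gamma(s)] times the [n]-th term of [2F1(a, 1 - a; c; 1/2)], so the claim is Bailey's
    theorem combined with the reflection formula.  Writing [F(c)] for that series, a
    telescoping certificate gives [c (c + 1) F(c) = (c + a) (c + 1 - a) F(c + 2)]; as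
    [F(c + 2 N)] tends to 1, [F(c)] is the limit of
    [4^N (1 - z)_N (1 - w)_N / (c)_(2N)], which Gauss' limit evaluates in terms of
    [1 / Gamma(1 - z)], [1 / Gamma(1 - w)], [Gamma(c)] and the Wallis constant
    [2 Gamma(1/2)].  Reflection is Euler's sine product, obtained from the recurrence
    [(4 m^2 - 4 z^2) J_m = 2 m (2 m - 1) J_(m-1)] for
    [J_m = int_0^(pi/2) cos(2 z t) cos(t)^(2 m) dt], where [2 z J_0 = sin(pi z)] and
    [J_m] is asymptotic to its value at [z = 0]. *)

(** * Limits of complex sequences *)

(** Bailey's closed form involves Gamma at [(c + a) / 2] and [(c + 1 - a) / 2], so the quotient of
    its values is rational in [c] for shifts by 2, not for shifts by 1; this is why the contiguous
    relation jumps from [c] to [c + 2]. Letting the shift go to infinity is legitimate because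
    [|F(c) - 1| <= (|a| + 1)^2 / Re c], a bound that depends on [c] only through its real part.
    Positive integers are allowed for [w] and [z], and there Gamma(1 - z) or Gamma(1 - w) has a
    pole. So the proof never divides by these values: it works with reciprocal Gauss products, which
    converge at 1 - z to sin(pi z) / pi * Gamma(z) whenever Gamma(z) is defined. Since [CGamma] is
    only known as a limit, Gamma identities are obtained from exact identities between Gauss
    products at a finite index, up to factors whose limit is explicit. *)

Definition Clim (u : nat -> CC) (l : CC) : Prop :=
  is_lim_seq (fun n => Cmod (u n - l)) 0%R.

Lemma Clim_eventually (u : nat -> CC) (l : CC) (eps : R) :
  Clim u l -> (0 < eps)%R -> eventually (fun n => Cmod (u n - l) < eps)%R.
Proof.
intros H He; apply is_lim_seq_spec in H.
destruct (H (mkposreal _ He)) as [N HN]; exists N; intros n Hn.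
specialize (HN n Hn); simpl in HN.
now rewrite Rminus_0_r, Rabs_pos_eq in HN by apply Cmod_ge_0.
Qed.

(** Balls of [C_UniformSpace] are boxes in the two coordinates, while [Clim] uses discs. A disc lies
    in the box of the same radius, and a box of radius r lies in the disc of radius [sqrt 2 * r],
    whence the factor in the second half. *)
Lemma Clim_filterlim (u : nat -> CC) (l : CC) :
  Clim u l <->
  @filterlim nat C_UniformSpace u eventually (@locally C_UniformSpace l).
Proof.
split; intros H.
- apply filterlim_locally; intros eps.
  destruct (Clim_eventually u l eps H (cond_pos eps)) as [N HN].
  exists N; intros n Hn.
  apply C_NormedModule_mixin_compat1; exact (HN n Hn).
- apply is_lim_seq_spec; intros eps.
  assert (He : (0 < eps / sqrt 2)%R).
  { apply Rdiv_lt_0_compat; [apply eps | apply sqrt_lt_R0; lra]. }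
  destruct (proj1 (filterlim_locally u l) H (mkposreal _ He)) as [N HN].
  exists N; intros n Hn.
  rewrite Rminus_0_r, Rabs_pos_eq by apply Cmod_ge_0.
  generalize (C_NormedModule_mixin_compat2 l (u n) _ (HN n Hn)); simpl; intros h.
  replace (sqrt 2 * (eps / sqrt 2))%R with (pos eps) in h; [exact h|].
  field; apply Rgt_not_eq, sqrt_lt_R0; lra.
Qed.

Lemma Clim_unique (u : nat -> CC) (l m : CC) : Clim u l -> Clim u m -> l = m.
Proof.
intros Hl Hm.
apply Clim_filterlim in Hl; apply Clim_filterlim in Hm.
exact (@filterlim_locally_unique nat C_AbsRing C_NormedModule eventually
  (Proper_StrongProper _ eventually_filter) u l m Hl Hm).
Qed.

Lemma Clim_ext_loc (u v : nat -> CC) (l : CC) :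
  eventually (fun n => u n = v n) -> Clim u l -> Clim v l.
Proof.
intros [N HN]; apply is_lim_seq_ext_loc; exists N; intros n Hn.
now rewrite HN.
Qed.

Lemma Clim_ext (u v : nat -> CC) (l : CC) :
  (forall n, u n = v n) -> Clim u l -> Clim v l.
Proof. intros H; apply Clim_ext_loc; exists O; auto. Qed.

Lemma Clim_le_loc (u : nat -> CC) (l : CC) (b : nat -> R) :
  eventually (fun n => Cmod (u n - l) <= b n)%R -> is_lim_seq b 0%R -> Clim u l.
Proof.
intros [N HN] Hb.
refine (is_lim_seq_le_le_loc (fun _ => 0%R) _ b _ _ (is_lim_seq_const _) Hb).
exists N; intros n Hn; split; [apply Cmod_ge_0 | now apply HN].
Qed.

Lemma Clim_const (l : CC) : Clim (fun _ => l) l.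
Proof.
apply is_lim_seq_ext with (fun _ => 0%R); [|apply is_lim_seq_const].
intros _; replace (l - l) with (RtoC 0) by ring; now rewrite Cmod_0.
Qed.

Lemma Clim_plus (u v : nat -> CC) (l m : CC) :
  Clim u l -> Clim v m -> Clim (fun n => u n + v n) (l + m).
Proof.
intros Hu Hv.
apply Clim_le_loc with (fun n => Cmod (u n - l) + Cmod (v n - m))%R.
- exists O; intros n _.
  replace (u n + v n - (l + m)) with ((u n - l) + (v n - m)) by ring.
  apply Cmod_triangle.
- replace (Finite 0) with (Finite (0 + 0)) by (f_equal; ring).
  now apply is_lim_seq_plus'.
Qed.

Lemma Clim_mult (u v : nat -> CC) (l m : CC) :
  Clim u l -> Clim v m -> Clim (fun n => u n * v n) (l * m).
Proof.
intros Hu Hv.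
apply Clim_le_loc with (fun n => Cmod (u n - l) * Cmod (v n - m)
  + Cmod (u n - l) * Cmod m + Cmod l * Cmod (v n - m))%R.
- exists O; intros n _.
  replace (u n * v n - l * m)
    with ((u n - l) * (v n - m) + (u n - l) * m + l * (v n - m)) by ring.
  rewrite <- !Cmod_mult.
  eapply Rle_trans; [apply Cmod_triangle|].
  apply Rplus_le_compat_r, Cmod_triangle.
- replace (Finite 0) with (Finite (0 * 0 + 0 * Cmod m + Cmod l * 0)) by (f_equal; ring).
  repeat apply is_lim_seq_plus'; apply is_lim_seq_mult';
    first [assumption | apply is_lim_seq_const].
Qed.

Lemma Clim_scal (c : CC) (u : nat -> CC) (l : CC) :
  Clim u l -> Clim (fun n => c * u n) (c * l).
Proof. intros H; apply Clim_mult; [apply Clim_const | exact H]. Qed.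

Lemma Clim_minus (u v : nat -> CC) (l m : CC) :
  Clim u l -> Clim v m -> Clim (fun n => u n - v n) (l - m).
Proof.
intros Hu Hv.
replace (l - m) with (l + (- (1)) * m) by ring.
apply Clim_ext with (fun n => u n + (- (1)) * v n); [intros n; ring|].
now apply Clim_plus; [|apply Clim_scal].
Qed.

Lemma Clim_subseq (u : nat -> CC) (l : CC) (phi : nat -> nat) :
  filterlim phi eventually eventually -> Clim u l -> Clim (fun n => u (phi n)) l.
Proof. intros Hphi Hu; exact (is_lim_seq_subseq _ _ phi Hphi Hu). Qed.

Lemma Clim_RtoC (r : nat -> R) (l : R) :
  is_lim_seq r l -> Clim (fun n => RtoC (r n)) (RtoC l).
Proof.
intros H.
apply is_lim_seq_ext with (fun n => Rabs (r n - l)).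
- intros n; now rewrite <- RtoC_minus, Cmod_R.
- apply (is_lim_seq_abs_0 (fun n => r n - l)%R).
  replace (Finite 0) with (Finite (l - l)) by (f_equal; ring).
  apply is_lim_seq_minus'; [exact H | apply is_lim_seq_const].
Qed.

Lemma Clim_inv (u : nat -> CC) (l : CC) :
  l <> 0 -> Clim u l -> Clim (fun n => / u n) (/ l).
Proof.
intros Hl Hu.
assert (Hl' : (0 < Cmod l)%R) by now apply Cmod_gt_0.
apply Clim_le_loc with (fun n => (2 / (Cmod l * Cmod l)) * Cmod (u n - l))%R.
- destruct (Clim_eventually u l (Cmod l / 2) Hu ltac:(lra)) as [N HN].
  exists N; intros n Hn; specialize (HN n Hn).
  assert (Hun : (Cmod l / 2 <= Cmod (u n))%R).
  { generalize (Cmod_triangle (u n) (- (u n - l))); rewrite Cmod_opp.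
    replace (u n + - (u n - l)) with l by ring; lra. }
  assert (Hu0 : u n <> 0) by (apply Cmod_gt_0; lra).
  replace (/ u n - / l) with (- (u n - l) * / (u n * l)) by (field; auto).
  rewrite Cmod_mult, Cmod_opp, Cmod_inv, Cmod_mult
    by (now apply Cmult_neq_0).
  rewrite (Rmult_comm _ (Cmod (u n - l))).
  apply Rmult_le_compat_l; [apply Cmod_ge_0|].
  replace (2 / (Cmod l * Cmod l))%R with (/ (Cmod l / 2 * Cmod l))%R by (field; lra).
  apply Rinv_le_contravar; [nra|].
  apply Rmult_le_compat_r; lra.
- replace (Finite 0) with (Finite (2 / (Cmod l * Cmod l) * 0)) by (f_equal; ring).
  apply is_lim_seq_mult'; [apply is_lim_seq_const | exact Hu].
Qed.

Lemma Clim_bounded (u : nat -> CC) (l : CC) :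
  Clim u l -> exists M, eventually (fun n => Cmod (u n) <= M)%R.
Proof.
intros Hu.
destruct (Clim_eventually u l 1 Hu Rlt_0_1) as [N HN].
exists (Cmod l + 1)%R, N; intros n Hn; specialize (HN n Hn).
generalize (Cmod_triangle l (u n - l)).
replace (l + (u n - l)) with (u n) by ring; lra.
Qed.

Lemma Cmod_diff_telescope (u : nat -> CC) (b : nat -> R) (N : nat) :
  (forall n, (N <= n)%nat -> Cmod (u (S n) - u n) <= b n - b (S n))%R ->
  forall n k, (N <= n)%nat -> (Cmod (u (n + k)%nat - u n) <= b n - b (n + k)%nat)%R.
Proof.
intros H n k Hn; induction k as [|k IH].
- rewrite Nat.add_0_r; replace (u n - u n) with (RtoC 0) by ring.
  rewrite Cmod_0; lra.
- rewrite Nat.add_succ_r.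
  replace (u (S (n + k)) - u n)
    with ((u (S (n + k)) - u (n + k)%nat) + (u (n + k)%nat - u n)) by ring.
  eapply Rle_trans; [apply Cmod_triangle|].
  generalize (H (n + k)%nat ltac:(lia)); lra.
Qed.

(** A Cauchy criterion without series: [b n] bounds the whole movement of [u] after index n. *)
Lemma Clim_of_telescoping_bound (u : nat -> CC) (b : nat -> R) (N : nat) :
  (forall n, (N <= n)%nat -> Cmod (u (S n) - u n) <= b n - b (S n))%R ->
  is_lim_seq b 0%R ->
  exists l, Clim u l.
Proof.
intros H Hb.
pose proof (Cmod_diff_telescope u b N H) as Hd.
destruct (proj1 (@filterlim_locally_cauchy nat C_CompleteNormedModule eventually
  _ u)) as [l Hl].
- intros eps.
  assert (He : (0 < eps / 4)%R) by (generalize (cond_pos eps); lra).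
  apply is_lim_seq_spec in Hb.
  destruct (Hb (mkposreal _ He)) as [M HM]; simpl in HM.
  exists (fun n => (max N M <= n)%nat); split; [now exists (max N M)|].
  assert (K : forall n, (max N M <= n)%nat -> (Cmod (u n - u (max N M)) < eps / 2)%R).
  { intros n Hn; replace n with (max N M + (n - max N M))%nat by lia.
    eapply Rle_lt_trans; [apply Hd; lia|].
    generalize (HM (max N M) ltac:(lia)) (HM (max N M + (n - max N M))%nat ltac:(lia)).
    rewrite !Rminus_0_r; intros K1 K2; apply Rabs_def2 in K1; apply Rabs_def2 in K2; lra. }
  intros n m Hn Hm.
  apply C_NormedModule_mixin_compat1.
  change (Cmod (u m - u n) < eps)%R.
  replace (u m - u n) with ((u m - u (max N M)) + - (u n - u (max N M))) by ring.
  eapply Rle_lt_trans; [apply Cmod_triangle|]; rewrite Cmod_opp.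
  generalize (K n Hn) (K m Hm); lra.
- exists l; apply Clim_filterlim; exact Hl.
Qed.

Lemma Clim_dist_le (u : nat -> CC) (l c : CC) (B : R) :
  Clim u l -> eventually (fun n => Cmod (u n - c) <= B)%R -> (Cmod (l - c) <= B)%R.
Proof.
intros Hu [N HN].
assert (H : is_lim_seq (fun n => Cmod (u n - l) + B)%R (0 + B)%R).
{ apply is_lim_seq_plus'; [exact Hu | apply is_lim_seq_const]. }
rewrite Rplus_0_l in H.
refine (is_lim_seq_le_loc (fun _ => Cmod (l - c)) _ (Cmod (l - c)) B _ (is_lim_seq_const _) H).
exists N; intros n Hn; specialize (HN n Hn).
generalize (Cmod_triangle (- (u n - l)) (u n - c)); rewrite Cmod_opp.
replace (- (u n - l) + (u n - c)) with (l - c) by ring; lra.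
Qed.

Lemma lim_seq_inv_INR : is_lim_seq (fun n => / INR n)%R 0%R.
Proof.
replace (Finite 0) with (Rbar_inv p_infty) by reflexivity.
apply is_lim_seq_inv; [apply is_lim_seq_INR | discriminate].
Qed.

Lemma exp_le (x y : R) : (x <= y)%R -> (exp x <= exp y)%R.
Proof.
intros [H | ->]; [left; now apply exp_increasing | right; reflexivity].
Qed.

(** Convergence of an infinite product with factors [1 + e n]. Since [1 + x <= exp x], the partial
    products are bounded by the exponential of a telescoping sum; that bound [M] then makes the
    increments [u n * e n] telescope as well. *)
Lemma Clim_of_ratio (u e : nat -> CC) (K : R) (N : nat) :
  (1 <= N)%nat -> (0 <= K)%R ->
  (forall n, (N <= n)%nat -> u (S n) = u n * (1 + e n)) ->
  (forall n, (N <= n)%nat -> Cmod (e n) <= K * (/ INR n - / INR (S n)))%R ->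
  exists l, Clim u l.
Proof.
intros HN HK Hu He.
assert (Hb : forall n, (N <= n)%nat ->
  (Cmod (u n) <= Cmod (u N) * exp (K * (/ INR N - / INR n)))%R).
{ intros n Hn; induction Hn as [|n Hn IH].
  - replace (K * (/ INR N - / INR N))%R with 0%R by ring; rewrite exp_0; lra.
  - rewrite Hu, Cmod_mult by assumption.
    replace (K * (/ INR N - / INR (S n)))%R
      with (K * (/ INR N - / INR n) + K * (/ INR n - / INR (S n)))%R by ring.
    rewrite exp_plus, <- Rmult_assoc.
    apply Rmult_le_compat; try apply Cmod_ge_0; [exact IH|].
    eapply Rle_trans; [apply Cmod_triangle|]; rewrite Cmod_1.
    eapply Rle_trans; [|apply exp_ineq1_le].
    generalize (He n Hn); lra. }
set (M := (Cmod (u N) * exp (K * / INR N))%R).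
assert (HM : forall n, (N <= n)%nat -> (Cmod (u n) <= M)%R).
{ intros n Hn; eapply Rle_trans; [now apply Hb|].
  apply Rmult_le_compat_l; [apply Cmod_ge_0|].
  apply exp_le.
  apply Rmult_le_compat_l; [exact HK|].
  assert (0 < / INR n)%R by (apply Rinv_0_lt_compat, lt_0_INR; lia); lra. }
apply (Clim_of_telescoping_bound u (fun n => M * K * / INR n)%R N).
- intros n Hn; rewrite Hu by assumption.
  replace (u n * (1 + e n) - u n) with (u n * e n) by ring.
  rewrite Cmod_mult.
  replace (M * K * / INR n - M * K * / INR (S n))%R
    with (M * (K * (/ INR n - / INR (S n))))%R by ring.
  apply Rmult_le_compat; try apply Cmod_ge_0; auto.
- replace (Finite 0) with (Finite (M * K * 0)) by (f_equal; ring).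
  apply is_lim_seq_mult'; [apply is_lim_seq_const | apply lim_seq_inv_INR].
Qed.

(** [lim] is a total function with a meaning only on Cauchy filters; convergence supplies that
    condition, and uniqueness of limits does the rest. *)
Lemma CGamma_Clim (z l : CC) : Clim (gauss_term z) l -> CGamma z = l.
Proof.
intros H.
apply Clim_unique with (gauss_term z); [|exact H].
apply Clim_filterlim in H.
apply Clim_filterlim, filterlim_locally.
assert (P : ProperFilter (filtermap (gauss_term z) eventually))
  by (apply filtermap_proper_filter, eventually_filter).
apply (@complete_cauchy C_CompleteNormedModule _ P).
intros eps; exists l.
exact (proj1 (filterlim_locally (gauss_term z) l) H eps).
Qed.

Lemma Clim_is_series (u : nat -> CC) (l : CC) : Clim (sum_n u) l -> is_series u l.
Proof. intros H; exact (proj1 (Clim_filterlim _ _) H). Qed.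

(** * The complex exponential *)

Lemma Cexp_plus (x y : CC) : Cexp (x + y) = Cexp x * Cexp y.
Proof.
apply injective_projections; unfold Cexp, Re, Im; simpl; rewrite exp_plus, ?cos_plus, ?sin_plus; ring.
Qed.

Lemma Cexp_0 : Cexp 0 = 1.
Proof.
apply injective_projections; unfold Cexp, Re, Im; simpl; rewrite exp_0, ?cos_0, ?sin_0; ring.
Qed.

Lemma Cexp_opp_r (x : CC) : Cexp x * Cexp (- x) = 1.
Proof.
rewrite <- Cexp_plus; replace (x + - x) with (RtoC 0) by ring; apply Cexp_0.
Qed.

Lemma Cexp_neq_0 (x : CC) : Cexp x <> 0.
Proof.
intros H; apply C1_nz; rewrite <- (Cexp_opp_r x), H; ring.
Qed.

Lemma Cexp_opp (x : CC) : Cexp (- x) = / Cexp x.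
Proof.
rewrite <- (Cmult_1_l (/ Cexp x)), <- (Cexp_opp_r x).
field; apply Cexp_neq_0.
Qed.

Lemma Cexp_RtoC (x : R) : Cexp (RtoC x) = RtoC (exp x).
Proof.
apply injective_projections; unfold Cexp, Re, Im; simpl; rewrite ?cos_0, ?sin_0; ring.
Qed.

Lemma Cmod_le_Rabs (x : CC) : (Cmod x <= Rabs (Re x) + Rabs (Im x))%R.
Proof.
replace x with (RtoC (Re x) + Ci * RtoC (Im x)) at 1.
- eapply Rle_trans; [apply Cmod_triangle|].
  rewrite Cmod_mult, Cmod_Ci, !Cmod_R; lra.
- apply injective_projections; unfold Re, Im; simpl; ring.
Qed.

Lemma im_le_Cmod (x : CC) : (Rabs (Im x) <= Cmod x)%R.
Proof. eapply Rle_trans; [apply Rmax_r | apply Rmax_Cmod]. Qed.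

Lemma exp_sub_1_bound (a : R) :
  (Rabs a <= 1)%R -> (0 <= exp a - 1 - a <= 3 * a ^ 2)%R.
Proof.
intros Ha; split; [generalize (exp_ineq1_le a); lra|].
assert (He : (exp a <= 3)%R).
{ apply Rle_trans with (exp 1); [|apply exp_le_3].
  apply exp_le; apply Rabs_le_between in Ha; lra. }
generalize (exp_ineq1_le (- a)) (exp_pos a) (exp_plus a (- a)).
replace (a + - a)%R with 0%R by ring; rewrite exp_0; intros H1 H2 H3.
(* This is [1 - a <= exp (- a)] multiplied by [exp a]. *)
assert (H4 : (exp a - 1 <= a * exp a)%R).
{ assert (exp a * (1 + - a) <= exp a * exp (- a))%R
    by (apply Rmult_le_compat_l; lra); lra. }
destruct (Rle_lt_dec 0 a) as [H|H].
- assert (a * (exp a - 1) <= a * (a * exp a))%R by (apply Rmult_le_compat_l; lra).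
  assert (a * a * exp a <= a * a * 3)%R by (apply Rmult_le_compat_l; nra); lra.
- assert (- a * (1 - exp a) <= - a * - a)%R
    by (apply Rmult_le_compat_l; generalize (exp_ineq1_le a); lra).
  nra.
Qed.

Lemma one_sub_cos_bound (b : R) : (0 <= 1 - cos b <= b ^ 2 / 2)%R.
Proof.
replace b with (2 * (b / 2))%R by field; rewrite cos_2a_sin.
assert (H : (Rabs (sin (b / 2)) <= Rabs (b / 2))%R).
{ destruct (MVT_gen sin 0 (b / 2) cos) as [c [_ Hc]].
  - intros; auto_derive; [exact I | ring].
  - intros; apply continuity_sin.
  - rewrite sin_0, !Rminus_0_r in Hc; rewrite Hc, Rabs_mult.
    generalize (Rabs_pos (b / 2)); assert (Rabs (cos c) <= 1)%R
      by (apply Rabs_le, COS_bound); nra. }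
apply Rsqr_le_abs_1 in H; unfold Rsqr in H; nra.
Qed.

Lemma sin_sub_bound (b : R) : (Rabs (sin b - b) <= b ^ 2)%R.
Proof.
destruct (MVT_gen (fun x => sin x - x)%R 0 b (fun x => cos x - 1)%R) as [c [Hc1 Hc]].
- intros; auto_derive; [exact I | ring].
- intros; apply continuity_pt_minus; [apply continuity_sin|].
  apply derivable_continuous, derivable_id.
- rewrite sin_0, !Rminus_0_r in Hc; rewrite Hc, Rabs_mult.
  replace (b ^ 2)%R with (Rabs b * Rabs b)%R
    by (rewrite <- Rabs_mult, Rabs_pos_eq; [ring | apply Rle_0_sqr]).
  apply Rmult_le_compat_r; [apply Rabs_pos|].
  (* It remains to see [|cos c - 1| <= |b|]: the quadratic bound [c^2 / 2] suffices up to 2, and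
     beyond 2 the trivial bound 2 does. *)
  destruct (Rle_lt_dec (Rabs b) 2) as [H|H].
  + rewrite Rabs_left1 by (generalize (COS_bound c); lra).
    generalize (one_sub_cos_bound c).
    assert (Rabs c <= Rabs b)%R.
    { unfold Rmin, Rmax in Hc1; destruct (Rle_dec 0 b);
        unfold Rabs; destruct (Rcase_abs c), (Rcase_abs b); lra. }
    replace (c ^ 2)%R with (Rabs c * Rabs c)%R
      by (rewrite <- Rabs_mult, Rabs_pos_eq; [ring | apply Rle_0_sqr]).
    generalize (Rabs_pos c); nra.
  + apply Rabs_le; generalize (COS_bound c); lra.
Qed.

Lemma Cexp_bound (w : CC) :
  (Cmod w <= 1)%R -> (Cmod (Cexp w - 1 - w) <= 10 * Cmod w ^ 2)%R.
Proof.
intros Hw.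
assert (Ha : (Rabs (Re w) <= Cmod w)%R) by apply re_le_Cmod.
assert (Hb : (Rabs (Im w) <= Cmod w)%R) by apply im_le_Cmod.
rewrite Cmod2_alt in *.
destruct w as [a b]; simpl Re in *; simpl Im in *; set (m := Cmod (a, b)) in *.
eapply Rle_trans; [apply Cmod_le_Rabs|]; unfold Cexp; simpl Re; simpl Im.
assert (Ha1 : (Rabs a <= 1)%R) by lra.
pose proof (exp_sub_1_bound a Ha1) as He.
pose proof (one_sub_cos_bound b) as Hc.
pose proof (sin_sub_bound b) as Hs.
assert (He3 : (0 < exp a <= 3)%R).
{ split; [apply exp_pos|]; apply Rle_trans with (exp 1); [|apply exp_le_3].
  apply exp_le; apply Rabs_le_between in Ha1; lra. }
assert (H1 : (Rabs (exp a * cos b + - (1) + - a) <= 3 * a ^ 2 + 2 * b ^ 2)%R).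
{ replace (exp a * cos b + - (1) + - a)%R
    with ((exp a - 1 - a) - exp a * (1 - cos b))%R by ring.
  apply Rabs_le; nra. }
assert (H2 : (Rabs (exp a * sin b + - 0 + - b) <= 3 * b ^ 2 + 4 * Rabs a * Rabs b)%R).
{ replace (exp a * sin b + - 0 + - b)%R
    with (exp a * (sin b - b) + (exp a - 1) * b)%R by ring.
  eapply Rle_trans; [apply Rabs_triang|]; rewrite !Rabs_mult.
  apply Rplus_le_compat.
  - rewrite (Rabs_pos_eq (exp a)) by lra.
    generalize (Rabs_pos (sin b - b)); nra.
  - apply Rmult_le_compat_r; [apply Rabs_pos|].
    replace (a ^ 2)%R with (Rabs a * Rabs a)%R in He
      by (rewrite <- Rabs_mult, Rabs_pos_eq; [ring | apply Rle_0_sqr]).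
    assert (Ha2 : (Rabs a * Rabs a <= Rabs a)%R) by (generalize (Rabs_pos a); nra).
    replace (exp a - 1)%R with ((exp a - 1 - a) + a)%R by ring.
    eapply Rle_trans; [apply Rabs_triang|]; rewrite (Rabs_pos_eq (exp a - 1 - a)) by lra.
    lra. }
(* Absorbs the cross term: the total becomes [5 a^2 + 7 b^2], below the generous constant 10. *)
assert (H3 : (2 * (Rabs a * Rabs b) <= a ^ 2 + b ^ 2)%R).
{ rewrite <- (pow2_abs a), <- (pow2_abs b).
  generalize (pow2_ge_0 (Rabs a - Rabs b)); lra. }
generalize (pow2_ge_0 a) (pow2_ge_0 b); lra.
Qed.

(** The addition formula moves the question to 0, where [Cexp_bound] gives [|Cexp y - 1| <= 11 |y|]
    for [|y| <= 1]. *)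
Lemma Clim_Cexp_scal (x : CC) (r : nat -> R) (l : R) :
  is_lim_seq r l -> Clim (fun n => Cexp (x * RtoC (r n))) (Cexp (x * RtoC l)).
Proof.
intros Hr.
apply Clim_ext with (fun n => Cexp (x * RtoC l) * Cexp (x * RtoC (r n - l))).
{ intros n; rewrite <- Cexp_plus, RtoC_minus; f_equal; ring. }
cut (Clim (fun n => Cexp (x * RtoC (r n - l))) 1).
{ intros H; apply (Clim_scal (Cexp (x * RtoC l))) in H; now rewrite Cmult_1_r in H. }
assert (H : Clim (fun n => x * RtoC (r n - l)) 0).
{ rewrite <- (Cmult_0_r x); apply Clim_scal, Clim_RtoC.
  replace (Finite 0) with (Finite (l - l)) by (f_equal; ring).
  apply is_lim_seq_minus'; [exact Hr | apply is_lim_seq_const]. }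
apply Clim_le_loc with (fun n => 11 * Cmod (x * RtoC (r n - l) - 0))%R.
- destruct (Clim_eventually _ _ 1 H Rlt_0_1) as [N HN].
  exists N; intros n Hn; specialize (HN n Hn).
  set (y := x * RtoC (r n - l)) in *.
  replace (y - 0) with y in * by ring.
  generalize (Cexp_bound y ltac:(lra)) (Cmod_triangle (Cexp y - 1 - y) y) (Cmod_ge_0 y).
  replace (Cexp y - 1 - y + y) with (Cexp y - 1) by ring; nra.
- replace (Finite 0) with (Finite (11 * 0)) by (f_equal; ring).
  apply is_lim_seq_mult'; [apply is_lim_seq_const | exact H].
Qed.

(** * Pochhammer symbols and Gauss' product *)

Lemma RtoC_INR_S (n : nat) : RtoC (INR (S n)) = RtoC (INR n) + 1.
Proof. now rewrite S_INR, RtoC_plus. Qed.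

Lemma RtoC_neq_0 (x : R) : x <> 0%R -> RtoC x <> 0.
Proof. intros H K; now apply H, RtoC_inj. Qed.

Lemma RtoC_INR_neq_0 (n : nat) : (1 <= n)%nat -> RtoC (INR n) <> 0.
Proof. intros H; apply RtoC_neq_0, not_0_INR; lia. Qed.

Lemma INR_S_C_neq_0 (n : nat) : RtoC (INR n) + 1 <> 0.
Proof. rewrite <- RtoC_INR_S; apply RtoC_INR_neq_0; lia. Qed.

Lemma RtoC_fact_neq_0 (n : nat) : RtoC (INR (fact n)) <> 0.
Proof. apply RtoC_neq_0, INR_fact_neq_0. Qed.

Lemma poch_S (a : CC) (n : nat) : poch a (S n) = poch a n * (a + RtoC (INR n)).
Proof. reflexivity. Qed.

Lemma poch_S_l (a : CC) (n : nat) : poch a (S n) = a * poch (a + 1) n.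
Proof.
induction n as [|n IH]; [simpl; ring|].
rewrite poch_S, IH, poch_S, RtoC_INR_S; ring.
Qed.

Lemma Cplus_neq_0_of_neq_opp (a b : CC) : a <> - b -> a + b <> 0.
Proof. intros H K; apply H; replace a with ((a + b) - b) by ring; rewrite K; ring. Qed.

Lemma poch_neq_0 (a : CC) (n : nat) :
  (forall k : nat, a <> - RtoC (INR k)) -> poch a n <> 0.
Proof.
intros H; induction n as [|n IH]; [apply C1_nz|].
rewrite poch_S; apply Cmult_neq_0; [exact IH|].
apply Cplus_neq_0_of_neq_opp, H.
Qed.

Lemma Cpowr_plus (a : R) (x y : CC) : Cpowr a (x + y) = Cpowr a x * Cpowr a y.
Proof. unfold Cpowr; rewrite <- Cexp_plus; f_equal; ring. Qed.

Lemma Cpowr_1 (a : R) : (0 < a)%R -> Cpowr a 1 = RtoC a.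
Proof.
intros Ha; unfold Cpowr; rewrite Cmult_1_l, Cexp_RtoC, exp_ln; auto.
Qed.

Lemma Cpowr_neq_0 (a : R) (x : CC) : Cpowr a x <> 0.
Proof. apply Cexp_neq_0. Qed.

(** * Convergence of Gauss' product *)

Lemma ln_le_sub_1 (x : R) : (0 < x)%R -> (ln x <= x - 1)%R.
Proof.
intros Hx; generalize (exp_ineq1_le (ln x)); rewrite exp_ln by assumption; lra.
Qed.

Lemma ln_INR_S_bounds (n : nat) : (1 <= n)%nat ->
  (/ INR (S n) <= ln (INR (S n)) - ln (INR n) <= / INR n)%R.
Proof.
intros Hn.
assert (H0 : (0 < INR n)%R) by (apply lt_0_INR; lia).
assert (H1 : (0 < INR (S n))%R) by (apply lt_0_INR; lia).
split.
- assert (H : (ln (INR n * / INR (S n)) <= INR n * / INR (S n) - 1)%R).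
  { apply ln_le_sub_1, Rmult_lt_0_compat; [|apply Rinv_0_lt_compat]; assumption. }
  rewrite ln_mult, ln_Rinv in H by (try apply Rinv_0_lt_compat; assumption).
  replace (INR n * / INR (S n) - 1)%R with (- / INR (S n))%R in H; [lra|].
  rewrite S_INR in *; field; lra.
- assert (H : (ln (INR (S n) * / INR n) <= INR (S n) * / INR n - 1)%R).
  { apply ln_le_sub_1, Rmult_lt_0_compat; [|apply Rinv_0_lt_compat]; assumption. }
  rewrite ln_mult, ln_Rinv in H by (try apply Rinv_0_lt_compat; assumption).
  replace (INR (S n) * / INR n - 1)%R with (/ INR n)%R in H; [lra|].
  rewrite S_INR in *; field; lra.
Qed.

Lemma Cmod_add_INR_ge (z : CC) (n : nat) : (INR n - Cmod z <= Cmod (z + RtoC (INR n)))%R.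
Proof.
generalize (Cmod_triangle (z + RtoC (INR n)) (- z)); rewrite Cmod_opp.
replace (z + RtoC (INR n) + - z) with (RtoC (INR n)) by ring.
rewrite Cmod_R, Rabs_pos_eq by apply pos_INR; lra.
Qed.

Definition gauss_ratio_err (z : CC) (n : nat) : CC :=
  RtoC (INR (S n)) * Cexp (z * RtoC (ln (INR (S n)) - ln (INR n)))
  / (z + RtoC (INR (S n))) - 1.

Lemma gauss_term_S (z : CC) (n : nat) :
  (forall k : nat, z <> - RtoC (INR k)) -> 
  gauss_term z (S n) = gauss_term z n * (1 + gauss_ratio_err z n).
Proof.
intros Hz; unfold gauss_term, gauss_ratio_err.
rewrite (poch_S z (S n)).
assert (HP : Cpowr (INR (S n)) z
  = Cpowr (INR n) z * Cexp (z * RtoC (ln (INR (S n)) - ln (INR n)))).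
{ unfold Cpowr; rewrite <- Cexp_plus, RtoC_minus; f_equal; ring. }
rewrite HP, fact_simpl, mult_INR, RtoC_mult.
field; split; [apply Cplus_neq_0_of_neq_opp, Hz | now apply poch_neq_0].
Qed.

(** With L = ln(n+1) - ln n and [Cexp (z L) = 1 + z L + r], the first-order terms cancel: the error
    is [(z (L - 1/(n+1)) + r) * (n+1) / (z+n+1)]. As L lies between 1/(n+1) and 1/n, both summands
    are of the size of 1/n - 1/(n+1). The threshold on n gives [|z L| <= 1] and a last factor of
    modulus at most 2. *)
Lemma gauss_ratio_err_bound (z : CC) (n : nat) :
  (2 * (Cmod z + 1) <= INR n)%R ->
  (Cmod (gauss_ratio_err z n)
   <= (2 * Cmod z + 40 * Cmod z ^ 2) * (/ INR n - / INR (S n)))%R.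
Proof.
intros Hn; pose proof (Cmod_ge_0 z) as Hz0.
assert (Hn1 : (1 <= n)%nat) by (apply INR_le; simpl; lra).
assert (H0 : (0 < INR n)%R) by lra.
pose proof (ln_INR_S_bounds n Hn1) as HL.
unfold gauss_ratio_err; set (L := (ln (INR (S n)) - ln (INR n))%R) in *.
assert (Hi : (0 < / INR n)%R) by now apply Rinv_0_lt_compat.
assert (HS : INR (S n) = (INR n + 1)%R) by apply S_INR.
assert (HiS : (0 < / INR (S n))%R) by (apply Rinv_0_lt_compat; lra).
assert (HzL : (Cmod (z * RtoC L) <= Cmod z * / INR n)%R).
{ rewrite Cmod_mult, Cmod_R, Rabs_pos_eq by lra.
  apply Rmult_le_compat_l; lra. }
assert (HzL1 : (Cmod (z * RtoC L) <= 1)%R).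
{ eapply Rle_trans; [exact HzL|].
  apply Rmult_le_reg_r with (INR n); [exact H0|].
  rewrite Rmult_assoc, Rinv_l by lra; lra. }
pose proof (Cexp_bound _ HzL1) as Hr.
set (r := Cexp (z * RtoC L) - 1 - z * RtoC L) in *.
replace (Cexp (z * RtoC L)) with (1 + z * RtoC L + r) by (unfold r; ring).
assert (Hd : (INR (S n) / 2 <= Cmod (z + RtoC (INR (S n))))%R).
{ eapply Rle_trans; [|apply Cmod_add_INR_ge]; lra. }
assert (Hd0 : z + RtoC (INR (S n)) <> 0) by (apply Cmod_gt_0; lra).
replace (RtoC (INR (S n)) * (1 + z * RtoC L + r) / (z + RtoC (INR (S n))) - 1)
  with ((z * RtoC (L - / INR (S n)) + r)
        * (RtoC (INR (S n)) / (z + RtoC (INR (S n))))).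
2:{ rewrite RtoC_minus, RtoC_inv by lra; field; split; [exact Hd0|].
    apply RtoC_neq_0; lra. }
rewrite Cmod_mult.
assert (H2 : (Cmod (RtoC (INR (S n)) / (z + RtoC (INR (S n)))) <= 2)%R).
{ rewrite Cmod_div, Cmod_R, Rabs_pos_eq by (exact Hd0 || lra).
  apply Rmult_le_reg_r with (Cmod (z + RtoC (INR (S n)))); [lra|].
  unfold Rdiv; rewrite Rmult_assoc, Rinv_l by lra; lra. }
assert (H3 : (Cmod (z * RtoC (L - / INR (S n))) <= Cmod z * (/ INR n - / INR (S n)))%R).
{ rewrite Cmod_mult, Cmod_R, Rabs_pos_eq by lra.
  apply Rmult_le_compat_l; lra. }
assert (H4 : (Cmod r <= 20 * Cmod z ^ 2 * (/ INR n - / INR (S n)))%R).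
{ eapply Rle_trans; [exact Hr|].
  apply Rle_trans with (10 * (Cmod z * / INR n) ^ 2)%R.
  - apply Rmult_le_compat_l; [lra|].
    apply pow_incr; split; [apply Cmod_ge_0 | exact HzL].
  - assert (H5 : (/ INR n * / INR n <= 2 * (/ INR n - / INR (S n)))%R).
    { replace (/ INR n - / INR (S n))%R with (/ INR n * / INR (S n))%R
        by (rewrite HS; field; lra).
      replace (2 * (/ INR n * / INR (S n)))%R with (/ INR n * / (INR (S n) / 2))%R
        by (field; lra).
      apply Rmult_le_compat_l; [lra|].
      apply Rinv_le_contravar; lra. }
    generalize (pow2_ge_0 (Cmod z)); nra. }
pose proof (Cmod_triangle (z * RtoC (L - / INR (S n))) r) as H5.
apply Rle_trans with (Cmod (z * RtoC (L - / INR (S n)) + r) * 2)%R.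
- apply Rmult_le_compat_l; [apply Cmod_ge_0 | exact H2].
- lra.
Qed.

Lemma gauss_term_Clim (z : CC) :
  (forall k : nat, z <> - RtoC (INR k)) -> Clim (gauss_term z) (CGamma z).
Proof.
intros Hz.
destruct (INR_unbounded (2 * (Cmod z + 1))) as [N HN].
pose proof (Cmod_ge_0 z) as Hz0.
destruct (Clim_of_ratio (gauss_term z) (gauss_ratio_err z)
  (2 * Cmod z + 40 * Cmod z ^ 2) N) as [l Hl].
- apply INR_le; simpl; lra.
- generalize (pow2_ge_0 (Cmod z)); lra.
- intros n _; now apply gauss_term_S.
- intros n Hn; apply gauss_ratio_err_bound.
  apply le_INR in Hn; lra.
- now rewrite (CGamma_Clim z l Hl).
Qed.

Lemma Clim_INR_div_add (c : CC) :
  Clim (fun n => RtoC (INR n) / (c + RtoC (INR n))) 1.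
Proof.
assert (H : Clim (fun n => 1 + c * RtoC (/ INR n)) 1).
{ cut (Clim (fun n => 1 + c * RtoC (/ INR n)) (1 + c * 0)).
  { now rewrite Cmult_0_r, Cplus_0_r. }
  apply Clim_plus; [apply Clim_const|].
  apply Clim_scal, Clim_RtoC, lim_seq_inv_INR. }
apply (Clim_inv _ _ C1_nz) in H.
replace (/ 1) with (RtoC 1) in H by (field; apply C1_nz).
revert H; apply Clim_ext_loc.
destruct (INR_unbounded (Cmod c)) as [N HN].
exists (S N); intros n Hn.
assert (HNn : (INR N <= INR n)%R) by (apply le_INR; lia).
assert (H0 : (0 < INR n)%R) by (apply lt_0_INR; lia).
rewrite RtoC_inv by lra.
assert (H1 : c + RtoC (INR n) <> 0).
{ apply Cmod_gt_0; eapply Rlt_le_trans; [|apply Cmod_add_INR_ge]; lra. }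
field; repeat split; auto; try (apply RtoC_neq_0; lra).
Qed.

(** At each index the Gauss products at [z + 1] and [z] differ by the factor [z * n / (z + 1 + n)],
    which tends to [z]. *)
Lemma CGamma_succ (z : CC) :
  (forall k : nat, z <> - RtoC (INR k)) -> CGamma (z + 1) = z * CGamma z.
Proof.
intros Hz; apply CGamma_Clim.
replace (z * CGamma z) with (CGamma z * (z * 1)) by ring.
apply Clim_ext_loc with
  (fun n => gauss_term z n * (z * (RtoC (INR n) / (z + 1 + RtoC (INR n))))).
- exists 1%nat; intros n Hn; unfold gauss_term.
  assert (H1 : forall k, z + 1 <> - RtoC (INR k)).
  { intros k K; apply (Hz (S k)); rewrite RtoC_INR_S.
    replace z with (z + 1 - 1) by ring; rewrite K; ring. }
  rewrite Cpowr_plus, Cpowr_1 by (apply lt_0_INR; lia).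
  assert (E : poch z (S n) * (z + 1 + RtoC (INR n)) = z * poch (z + 1) (S n)).
  { rewrite <- poch_S_l, (poch_S z (S n)), RtoC_INR_S; ring. }
  pose proof (poch_neq_0 _ (S n) H1) as P1.
  pose proof (poch_neq_0 _ (S n) Hz) as P0.
  assert (Z1 : z + 1 + RtoC (INR n) <> 0) by apply Cplus_neq_0_of_neq_opp, H1.
  apply Ceq_minus.
  replace (RtoC (INR (fact n)) * Cpowr (INR n) z / poch z (S n)
      * (z * (RtoC (INR n) / (z + 1 + RtoC (INR n))))
    - RtoC (INR (fact n)) * (Cpowr (INR n) z * RtoC (INR n)) / poch (z + 1) (S n))
  with (RtoC (INR (fact n)) * Cpowr (INR n) z * RtoC (INR n)
    * (z * poch (z + 1) (S n) - poch z (S n) * (z + 1 + RtoC (INR n)))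
    / (poch z (S n) * (z + 1 + RtoC (INR n)) * poch (z + 1) (S n))).
  2:{ field; auto. }
  rewrite E; unfold Cdiv; ring.
- apply Clim_mult; [now apply gauss_term_Clim|].
  apply Clim_scal, Clim_INR_div_add.
Qed.

(** * Bailey's summation of 2F1(a, 1 - a; c; 1/2) *)

Lemma Cmod_geom_bound (v : nat -> CC) (q : R) (N : nat) :
  (0 < q)%R -> (forall n, (N <= n)%nat -> Cmod (v (S n)) <= q * Cmod (v n))%R ->
  forall n, (N <= n)%nat -> (Cmod (v n) <= Cmod (v N) / q ^ N * q ^ n)%R.
Proof.
intros Hq H n Hn; induction Hn as [|n Hn IH].
- right; field; apply pow_nonzero; lra.
- eapply Rle_trans; [now apply H|].
  apply Rmult_le_compat_l with (r := q) in IH; [|lra].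
  eapply Rle_trans; [exact IH|]; simpl; right; ring.
Qed.

Lemma Clim_0_of_geom (v : nat -> CC) (q : R) (N : nat) :
  (0 < q < 1)%R -> (forall n, (N <= n)%nat -> Cmod (v (S n)) <= q * Cmod (v n))%R ->
  Clim v 0.
Proof.
intros Hq H.
apply Clim_le_loc with (fun n => Cmod (v N) / q ^ N * q ^ n)%R.
- exists N; intros n Hn; replace (v n - 0) with (v n) by ring.
  apply Cmod_geom_bound; tauto || lra.
- replace (Finite 0) with (Finite (Cmod (v N) / q ^ N * 0)) by (f_equal; ring).
  apply is_lim_seq_mult'; [apply is_lim_seq_const|].
  apply is_lim_seq_geom; rewrite Rabs_pos_eq; lra.
Qed.

Lemma sum_n_S (u : nat -> CC) (n : nat) : sum_n u (S n) = sum_n u n + u (S n).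
Proof. exact (sum_Sn u n). Qed.

Lemma sum_n_ex_Clim_of_geom (v : nat -> CC) (q : R) (N : nat) :
  (0 < q < 1)%R -> (forall n, (N <= n)%nat -> Cmod (v (S n)) <= q * Cmod (v n))%R ->
  exists l, Clim (sum_n v) l.
Proof.
intros Hq H.
(* The dominating sequence is the sum of the geometric majorant of the tail after n; by the ratio
   bound it decreases by at least [|v (n+1)|]. *)
apply Clim_of_telescoping_bound with (fun n => / (1 - q) * Cmod (v (S n)))%R N.
- intros n Hn; rewrite sum_n_S.
  replace (sum_n v n + v (S n) - sum_n v n) with (v (S n)) by ring.
  generalize (H (S n) ltac:(lia)); intros K.
  apply Rmult_le_reg_l with (1 - q)%R; [lra|].
  replace ((1 - q) * (/ (1 - q) * Cmod (v (S n)) - / (1 - q) * Cmod (v (S (S n)))))%R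
    with (Cmod (v (S n)) - Cmod (v (S (S n))))%R by (field; lra).
  lra.
- replace (Finite 0) with (Finite (/ (1 - q) * 0)) by (f_equal; ring).
  apply is_lim_seq_mult'; [apply is_lim_seq_const|].
  apply (is_lim_seq_incr_1 (fun n => Cmod (v n))).
  apply is_lim_seq_ext with (fun n => Cmod (v n - 0)).
  + intros n; f_equal; ring.
  + exact (Clim_0_of_geom v q N Hq H).
Qed.

Definition hyp_term (a c : CC) (n : nat) : CC :=
  poch a n * poch (1 - a) n / (poch c n * RtoC (INR (fact n)) * RtoC (2 ^ n)).

Lemma RtoC_pow2_neq_0 (n : nat) : RtoC (2 ^ n) <> 0.
Proof. apply RtoC_neq_0, pow_nonzero; lra. Qed.

Lemma hyp_term_S (a c : CC) (n : nat) :
  (forall k : nat, c <> - RtoC (INR k)) ->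
  hyp_term a c (S n) = hyp_term a c n *
    ((a + RtoC (INR n)) * (1 - a + RtoC (INR n))
     / ((c + RtoC (INR n)) * (RtoC (INR n) + 1) * 2)).
Proof.
intros Hc; unfold hyp_term.
rewrite !poch_S, fact_simpl, mult_INR, RtoC_mult, RtoC_INR_S.
replace (RtoC (2 ^ S n)) with (2 * RtoC (2 ^ n)) by (rewrite <- RtoC_mult; reflexivity).
pose proof (RtoC_pow2_neq_0 n) as H2; pose proof (RtoC_fact_neq_0 n) as Hf.
pose proof (INR_S_C_neq_0 n) as Hn; pose proof (poch_neq_0 c n Hc) as Hp.
assert (Hcn : c + RtoC (INR n) <> 0) by apply Cplus_neq_0_of_neq_opp, Hc.
field; repeat split; auto; apply RtoC_neq_0; lra.
Qed.

Lemma nonpole_add (c : CC) (m : nat) :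
  (forall k : nat, c <> - RtoC (INR k)) ->
  forall k : nat, c + RtoC (INR m) <> - RtoC (INR k).
Proof.
intros Hc k K; apply (Hc (k + m)%nat).
rewrite plus_INR, RtoC_plus.
replace c with (c + RtoC (INR m) - RtoC (INR m)) by ring; rewrite K; ring.
Qed.

Lemma hyp_term_shift (a c : CC) (n : nat) :
  (forall k : nat, c <> - RtoC (INR k)) ->
  hyp_term a (c + 2) n = hyp_term a c n *
    (c * (c + 1) / ((c + RtoC (INR n)) * (c + RtoC (INR n) + 1))).
Proof.
intros Hc; unfold hyp_term.
assert (E : c * (c + 1) * poch (c + 2) n
  = poch c n * (c + RtoC (INR n)) * (c + RtoC (INR n) + 1)).
{ generalize (poch_S_l c (S n)); rewrite (poch_S_l (c + 1) n), !poch_S, RtoC_INR_S.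
  replace (c + 1 + 1) with (c + 2) by ring.
  intros E; rewrite <- Cmult_assoc, <- E; ring. }
pose proof (RtoC_pow2_neq_0 n) as H2; pose proof (RtoC_fact_neq_0 n) as Hf.
pose proof (poch_neq_0 c n Hc) as Hp.
assert (Hcn : c + RtoC (INR n) <> 0) by apply Cplus_neq_0_of_neq_opp, Hc.
assert (Hcn1 : c + RtoC (INR n) + 1 <> 0).
{ replace (c + RtoC (INR n) + 1) with (c + RtoC (INR (S n)))
    by (rewrite RtoC_INR_S; ring).
  apply Cplus_neq_0_of_neq_opp, Hc. }
assert (Hp2 : poch (c + 2) n <> 0).
{ apply poch_neq_0; intros k; replace (RtoC 2) with (RtoC (INR 2)) by (simpl; f_equal; ring).
  apply nonpole_add, Hc. }
(* [field] cannot use the relation [E], so the difference of the two sides is exhibited as a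
   multiple of the difference of the sides of [E]. *)
apply Ceq_minus.
match goal with |- ?x - ?y = _ => replace (x - y) with
  (poch a n * poch (1 - a) n / (RtoC (INR (fact n)) * RtoC (2 ^ n))
   * (poch c n * (c + RtoC (INR n)) * (c + RtoC (INR n) + 1)
      - c * (c + 1) * poch (c + 2) n)
   / (poch (c + 2) n * poch c n * (c + RtoC (INR n)) * (c + RtoC (INR n) + 1)))
  by (field; repeat split; auto) end.
rewrite E; unfold Cdiv; ring.
Qed.

(* The certificate [2 c (c + 1) n t_n / (c + n)] is found by Gosper's algorithm. *)
Lemma hyp_sum_contiguous (a c : CC) (n : nat) :
  (forall k : nat, c <> - RtoC (INR k)) ->
  (c + a) * (c + 1 - a) * sum_n (hyp_term a (c + 2)) n
  - c * (c + 1) * sum_n (hyp_term a c) n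
  = 2 * c * (c + 1) * (RtoC (INR (S n)) * hyp_term a c (S n)
                       / (c + RtoC (INR (S n)))).
Proof.
intros Hc.
assert (Hcn : forall n : nat, c + RtoC (INR n) <> 0)
  by (intros; apply Cplus_neq_0_of_neq_opp, Hc).
assert (Hcn1 : forall n : nat, c + RtoC (INR n) + 1 <> 0).
{ intros m; replace (c + RtoC (INR m) + 1) with (c + RtoC (INR (S m)))
    by (rewrite RtoC_INR_S; ring); apply Hcn. }
assert (H2 : RtoC 2 <> 0) by (apply RtoC_neq_0; lra).
assert (Step : forall n : nat,
  (c + a) * (c + 1 - a) * hyp_term a (c + 2) n - c * (c + 1) * hyp_term a c n
  = 2 * c * (c + 1) * (RtoC (INR (S n)) * hyp_term a c (S n) / (c + RtoC (INR (S n)))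
                       - RtoC (INR n) * hyp_term a c n / (c + RtoC (INR n)))).
{ intros m; rewrite hyp_term_shift, hyp_term_S, RtoC_INR_S by assumption.
  replace (c + (RtoC (INR m) + 1)) with (c + RtoC (INR m) + 1) by ring.
  field; repeat split; auto using INR_S_C_neq_0. }
induction n as [|n IH].
(* The factor n makes the certificate vanish at 0, so only the upper boundary term survives. *)
- rewrite !sum_O, Step; simpl (INR 0); unfold Cdiv; ring.
- rewrite !sum_n_S.
  replace ((c + a) * (c + 1 - a) * (sum_n (hyp_term a (c + 2)) n + hyp_term a (c + 2) (S n))
    - c * (c + 1) * (sum_n (hyp_term a c) n + hyp_term a c (S n)))
  with (((c + a) * (c + 1 - a) * sum_n (hyp_term a (c + 2)) n
    - c * (c + 1) * sum_n (hyp_term a c) n)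
    + ((c + a) * (c + 1 - a) * hyp_term a (c + 2) (S n)
       - c * (c + 1) * hyp_term a c (S n))) by ring.
  rewrite IH, (Step (S n)); ring.
Qed.

Lemma hyp_numerator_bound (a : CC) (n : nat) :
  (Cmod ((a + RtoC (INR n)) * (1 - a + RtoC (INR n))) <= (Cmod a + 1 + INR n) ^ 2)%R.
Proof.
rewrite Cmod_mult.
assert (Hn : Cmod (RtoC (INR n)) = INR n) by (rewrite Cmod_R; apply Rabs_pos_eq, pos_INR).
pose proof (Cmod_triangle a (RtoC (INR n))) as H1; rewrite Hn in H1.
pose proof (Cmod_triangle (1 - a) (RtoC (INR n))) as H2; rewrite Hn in H2.
pose proof (Cmod_triangle 1 (- a)) as H3; rewrite Cmod_opp, Cmod_1 in H3.
change (1 + - a) with (1 - a) in H3.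
replace ((Cmod a + 1 + INR n) ^ 2)%R
  with ((Cmod a + 1 + INR n) * (Cmod a + 1 + INR n))%R by ring.
apply Rmult_le_compat; try apply Cmod_ge_0; lra.
Qed.

(** Serves two regimes: n large with [c] fixed, where [d = n - |c|], and [Re c] large with n
    arbitrary, where [d = Re c + n]. *)
Lemma hyp_term_S_bound (a c : CC) (n : nat) (d q : R) :
  (forall k : nat, c <> - RtoC (INR k)) ->
  (0 < d)%R -> (d <= Cmod (c + RtoC (INR n)))%R ->
  ((Cmod a + 1 + INR n) ^ 2 <= q * (d * (INR n + 1) * 2))%R ->
  (Cmod (hyp_term a c (S n)) <= q * Cmod (hyp_term a c n))%R.
Proof.
intros Hc Hd Hdc Hq.
rewrite hyp_term_S, Cmod_mult, Rmult_comm by assumption.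
apply Rmult_le_compat_r; [apply Cmod_ge_0|].
pose proof (pos_INR n) as Hn.
assert (Hcn : c + RtoC (INR n) <> 0) by apply Cplus_neq_0_of_neq_opp, Hc.
assert (H2 : RtoC 2 <> 0) by (apply RtoC_neq_0; lra).
rewrite Cmod_div by (repeat apply Cmult_neq_0; auto using INR_S_C_neq_0).
rewrite (Cmod_mult _ 2), (Cmod_mult _ (RtoC (INR n) + 1)), <- RtoC_plus, !Cmod_R.
rewrite (Rabs_pos_eq (INR n + 1)), (Rabs_pos_eq 2) by lra.
assert (Hden : (0 < Cmod (c + RtoC (INR n)) * (INR n + 1) * 2)%R) by nra.
apply Rmult_le_reg_r with (Cmod (c + RtoC (INR n)) * (INR n + 1) * 2)%R; [exact Hden|].
unfold Rdiv; rewrite Rmult_assoc, Rinv_l, Rmult_1_r by lra.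
eapply Rle_trans; [apply hyp_numerator_bound|].
eapply Rle_trans; [exact Hq|].
assert (Hq0 : (0 <= q)%R).
{ destruct (Rle_lt_dec 0 q) as [|Hneg]; [assumption|exfalso].
  assert (0 < d * (INR n + 1) * 2)%R by nra.
  generalize (pow2_ge_0 (Cmod a + 1 + INR n)); nra. }
apply Rmult_le_compat_l; [exact Hq0|nra].
Qed.

(** The ratio of consecutive terms tends to the argument 1/2, and 3/4 leaves room. From 6 on,
    [(n + 1) * 3 / 4 <= n * 7 / 8], so the terms weighted by n decay geometrically too. *)
Lemma hyp_term_ratio_eventually (a c : CC) :
  (forall k : nat, c <> - RtoC (INR k)) ->
  exists N : nat, (6 <= N)%nat /\ forall n, (N <= n)%nat ->
    (Cmod (hyp_term a c (S n)) <= 3 / 4 * Cmod (hyp_term a c n))%R.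
Proof.
intros Hc.
destruct (INR_unbounded (8 * (Cmod a + Cmod c + 2))) as [N HN].
pose proof (Cmod_ge_0 a) as Ha; pose proof (Cmod_ge_0 c) as Hc0.
exists N; split; [apply INR_le; simpl; lra|]; intros n Hn; apply le_INR in Hn.
apply hyp_term_S_bound with (INR n - Cmod c)%R; auto.
- lra.
- apply Cmod_add_INR_ge.
(* The choice of [N] makes both [|a| + 1] and [|c|] at most n/8; then [(9/8)^2 / (2 * 7/8) = 81/112]
   is below 3/4. *)
- assert (H1 : (Cmod a + 1 + INR n <= 9 / 8 * INR n)%R) by lra.
  assert (H2 : (7 / 8 * INR n <= INR n - Cmod c)%R) by lra.
  apply Rle_trans with ((9 / 8 * INR n) ^ 2)%R; [apply pow_incr; lra|].
  apply Rle_trans with (3 / 4 * (7 / 8 * INR n * INR n * 2))%R; [nra|].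
  apply Rmult_le_compat_l; [lra|]; apply Rmult_le_compat_r; [lra|].
  apply Rmult_le_compat; lra.
Qed.

Lemma hyp_sum_ex_Clim (a c : CC) :
  (forall k : nat, c <> - RtoC (INR k)) -> exists l, Clim (sum_n (hyp_term a c)) l.
Proof.
intros Hc; destruct (hyp_term_ratio_eventually a c Hc) as [N [_ HN]].
apply (sum_n_ex_Clim_of_geom _ (3 / 4) N); [lra | exact HN].
Qed.

Lemma hyp_sum_Clim_shift (a c l : CC) :
  (forall k : nat, c <> - RtoC (INR k)) ->
  Clim (sum_n (hyp_term a (c + 2))) l ->
  Clim (sum_n (hyp_term a c)) ((c + a) * (c + 1 - a) / (c * (c + 1)) * l).
Proof.
intros Hc Hl.
assert (Hc0 : c <> 0) by (intros K; apply (Hc O); rewrite K; simpl; ring).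
assert (Hc1 : c + 1 <> 0).
{ apply Cplus_neq_0_of_neq_opp; exact (Hc 1%nat). }
destruct (hyp_term_ratio_eventually a c Hc) as [N [HN6 HN]].
assert (H0 : Clim (fun n => RtoC (INR n) * hyp_term a c n) 0).
{ apply (Clim_0_of_geom _ (7 / 8) N); [lra|]; intros n Hn.
  rewrite !Cmod_mult, !Cmod_R, !Rabs_pos_eq by apply pos_INR.
  assert (Hn6 : (6 <= INR n)%R).
  { replace 6%R with (INR 6) by (simpl; ring); apply le_INR; lia. }
  apply Rle_trans with (INR (S n) * (3 / 4 * Cmod (hyp_term a c n)))%R.
  - apply Rmult_le_compat_l; [apply pos_INR | now apply HN].
  - rewrite S_INR; generalize (Cmod_ge_0 (hyp_term a c n)); nra. }
(* The boundary term of [hyp_sum_contiguous] vanishes in the limit: [n / (c + n)] tends to 1 and the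
   term itself to 0. *)
assert (H1 : Clim (fun n => RtoC (INR n) * hyp_term a c n / (c + RtoC (INR n))) 0).
{ assert (K : Clim (fun n => RtoC (INR n) / (c + RtoC (INR n)) * hyp_term a c n) (1 * 0)).
  { apply Clim_mult; [apply Clim_INR_div_add|].
    apply (Clim_0_of_geom _ (3 / 4) N); [lra | exact HN]. }
  rewrite Cmult_0_r in K; revert K; apply Clim_ext; intros n; unfold Cdiv; ring. }
apply (Clim_subseq _ _ S) in H1; [|apply eventually_subseq; intros; lia].
apply (Clim_scal (2 * c * (c + 1))) in H1.
apply (Clim_scal ((c + a) * (c + 1 - a))) in Hl.
pose proof (Clim_scal (/ (c * (c + 1))) _ _ (Clim_minus _ _ _ _ Hl H1)) as H.
replace ((c + a) * (c + 1 - a) / (c * (c + 1)) * l)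
  with (/ (c * (c + 1)) * ((c + a) * (c + 1 - a) * l - 2 * c * (c + 1) * 0))
  by (field; repeat split; auto).
revert H; apply Clim_ext; intros n.
rewrite <- hyp_sum_contiguous by assumption.
field; repeat split; auto.
Qed.

(** The product of the factors [(x + a) (x + 1 - a) / (x (x + 1))] over x = c, c + 2, ..., c + 2 N -
    2. Halving turns the steps of 2 in the numerator into Pochhammer symbols, at the cost of
    [4 ^ N]. *)
Definition bailey_prod (a c : CC) (N : nat) : CC :=
  RtoC (4 ^ N) * poch ((c + a) / 2) N * poch ((c + 1 - a) / 2) N / poch c (2 * N).

Lemma bailey_prod_S (a c : CC) (N : nat) :
  (forall k : nat, c <> - RtoC (INR k)) ->
  bailey_prod a c (S N) = bailey_prod a c N *
    ((c + RtoC (INR (2 * N)) + a) * (c + RtoC (INR (2 * N)) + 1 - a)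
     / ((c + RtoC (INR (2 * N))) * (c + RtoC (INR (2 * N)) + 1))).
Proof.
intros Hc; unfold bailey_prod.
replace (2 * S N)%nat with (S (S (2 * N))) by lia.
rewrite !poch_S, RtoC_INR_S.
replace (RtoC (4 ^ S N)) with (4 * RtoC (4 ^ N)) by (rewrite <- RtoC_mult; reflexivity).
pose proof (poch_neq_0 c (2 * N) Hc) as Hp.
pose proof (Cplus_neq_0_of_neq_opp _ _ (Hc (2 * N)%nat)) as H0.
pose proof (Cplus_neq_0_of_neq_opp _ _ (Hc (S (2 * N)))) as H1.
rewrite RtoC_INR_S, Cplus_assoc in H1.
rewrite mult_INR, RtoC_mult in *; simpl (INR 2) in *.
replace (RtoC (1 + 1)) with (RtoC 2) in * by (f_equal; ring).
rewrite Cplus_assoc.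
field; repeat split; auto; apply RtoC_neq_0; lra.
Qed.

Lemma hyp_sum_Clim_iter (a c : CC) (N : nat) :
  (forall k : nat, c <> - RtoC (INR k)) ->
  forall l, Clim (sum_n (hyp_term a (c + RtoC (INR (2 * N))))) l ->
  Clim (sum_n (hyp_term a c)) (bailey_prod a c N * l).
Proof.
intros Hc; induction N as [|N IH]; intros l Hl.
- simpl in Hl; rewrite Cplus_0_r in Hl.
  replace (bailey_prod a c 0 * l) with l; [exact Hl|].
  unfold bailey_prod; simpl; field; apply C1_nz.
- rewrite bailey_prod_S, <- Cmult_assoc by assumption.
  apply IH, hyp_sum_Clim_shift; [now apply nonpole_add|].
  replace (c + RtoC (INR (2 * N)) + 2) with (c + RtoC (INR (2 * S N))); [exact Hl|].
  replace (2 * S N)%nat with (S (S (2 * N))) by lia.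
  rewrite !RtoC_INR_S; ring.
Qed.

(** All term ratios are at most 1/2, so the sum without its leading 1 is at most twice its first
    term, and that term is at most [(|a| + 1)^2 / (2 Re c)]. *)
Lemma hyp_sum_dist_1 (a c l : CC) :
  (forall k : nat, c <> - RtoC (INR k)) ->
  ((Cmod a + 1) ^ 2 <= Re c)%R ->
  Clim (sum_n (hyp_term a c)) l ->
  (Cmod (l - 1) <= (Cmod a + 1) ^ 2 / Re c)%R.
Proof.
intros Hc HA Hl.
pose proof (Cmod_ge_0 a) as Ha.
assert (HK : (1 <= Re c)%R) by nra.
assert (Hre : forall n : nat, (Re c + INR n <= Cmod (c + RtoC (INR n)))%R).
{ intros n; eapply Rle_trans; [|apply re_le_Cmod].
  replace (Re (c + RtoC (INR n))) with (Re c + INR n)%R by (unfold Re; simpl; ring).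
  apply Rle_abs. }
assert (H0 : sum_n (hyp_term a c) 0 = RtoC 1).
{ rewrite sum_O; unfold hyp_term; simpl; field; apply C1_nz. }
assert (Hhalf : forall n, (Cmod (hyp_term a c (S n)) <= / 2 * Cmod (hyp_term a c n))%R).
{ intros n; pose proof (pos_INR n) as Hn.
  apply hyp_term_S_bound with (Re c + INR n)%R; auto; [lra|].
  replace (/ 2 * ((Re c + INR n) * (INR n + 1) * 2))%R
    with (Re c + (Re c + 1) * INR n + INR n ^ 2)%R by field.
  (* From [2 x <= x^2 + 1] with [x = |a| + 1]; it compares the coefficients of n in the two
     quadratics. *)
  assert (2 * (Cmod a + 1) <= Re c + 1)%R by nra.
  nra. }
assert (H1 : (2 * Cmod (hyp_term a c 1) <= (Cmod a + 1) ^ 2 / Re c)%R).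
{ assert (K : (Cmod (hyp_term a c 1)
      <= (Cmod a + 1) ^ 2 / Re c / 2 * Cmod (hyp_term a c 0))%R).
  { apply hyp_term_S_bound with (Re c); auto; [lra| |].
    - generalize (Hre O); simpl; rewrite Rplus_0_r; auto.
    - simpl (INR 0); right; field; lra. }
  rewrite sum_O in H0; rewrite H0, Cmod_1 in K; lra. }
apply Clim_dist_le with (sum_n (hyp_term a c)); [exact Hl|].
exists O; intros n _.
pose proof (Cmod_diff_telescope (sum_n (hyp_term a c))
  (fun n => 2 * Cmod (hyp_term a c (S n)))%R 0) as HT.
assert (HT' := HT (fun n _ => ltac:(rewrite sum_n_S;
  replace (sum_n (hyp_term a c) n + hyp_term a c (S n) - sum_n (hyp_term a c) n)
    with (hyp_term a c (S n)) by ring;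
  generalize (Hhalf (S n)); lra)) O n (le_n O)).
rewrite H0 in HT'; simpl (0 + n)%nat in HT'.
eapply Rle_trans; [exact HT'|].
generalize (Cmod_ge_0 (hyp_term a c (S n))); lra.
Qed.

(** Write P_n for [bailey_prod a c n]. Iteration gives [F(c) = P_n F(c + 2 n)], so
    [P_n - F(c) = - P_n (F(c + 2 n) - 1)]: a bounded factor times one that is O(1/n). *)
Lemma bailey_sum (a c L : CC) :
  (forall k : nat, c <> - RtoC (INR k)) ->
  Clim (bailey_prod a c) L -> Clim (sum_n (hyp_term a c)) L.
Proof.
intros Hc HL.
destruct (hyp_sum_ex_Clim a c Hc) as [l Hl].
replace L with l; [exact Hl|].
apply Clim_unique with (bailey_prod a c); [|exact HL].
destruct (Clim_bounded _ _ HL) as [M [N0 HM]].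
(* From [N1] on, [Re c + 2 n >= n + (|a| + 1)^2]: this permits [hyp_sum_dist_1] and leaves n in the
   denominator of its bound. *)
destruct (INR_unbounded ((Cmod a + 1) ^ 2 + Cmod c)) as [N1 HN1].
assert (HM0 : (0 <= M)%R) by (eapply Rle_trans; [apply Cmod_ge_0 | apply (HM N0 (le_n _))]).
apply Clim_le_loc with (fun n => M * (Cmod a + 1) ^ 2 * / INR n)%R.
- exists (max (max N0 N1) 1); intros n Hn.
  destruct (hyp_sum_ex_Clim a _ (nonpole_add c (2 * n) Hc)) as [l' Hl'].
  pose proof (Clim_unique _ _ _ (hyp_sum_Clim_iter a c n Hc l' Hl') Hl) as E.
  assert (Hn1 : (INR N1 <= INR n)%R) by (apply le_INR; lia).
  assert (Hn0 : (1 <= INR n)%R) by (apply (le_INR 1); lia).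
  assert (Hre : (INR n + (Cmod a + 1) ^ 2 <= Re (c + RtoC (INR (2 * n))))%R).
  { replace (Re (c + RtoC (INR (2 * n)))) with (Re c + 2 * INR n)%R
      by (rewrite mult_INR; unfold Re; simpl; ring).
    generalize (re_le_Cmod c); intros K; apply Rabs_le_between in K; lra. }
  pose proof (pow2_ge_0 (Cmod a + 1)) as HA.
  assert (Hd : (Cmod (l' - 1) <= (Cmod a + 1) ^ 2 / Re (c + RtoC (INR (2 * n))))%R).
  { apply hyp_sum_dist_1; [now apply nonpole_add | lra | exact Hl']. }
  replace (bailey_prod a c n - l) with (- (bailey_prod a c n * (l' - 1)))
    by (rewrite <- E; ring).
  rewrite Cmod_opp, Cmod_mult, Rmult_assoc.
  apply Rmult_le_compat; try apply Cmod_ge_0; [apply HM; lia|].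
  eapply Rle_trans; [exact Hd|].
  apply Rmult_le_compat_l; [exact HA|].
  apply Rinv_le_contravar; lra.
- replace (Finite 0) with (Finite (M * (Cmod a + 1) ^ 2 * 0)) by (f_equal; ring).
  apply is_lim_seq_mult'; [apply is_lim_seq_const | apply lim_seq_inv_INR].
Qed.

(** * Euler's product for the sine *)

Section CosineMoments.
Open Scope R_scope.

Definition cos_moment (f : R -> R) (n : nat) : R :=
  RInt (fun t => f t * cos t ^ n) 0 (PI / 2).

Lemma cos_moment_is_RInt (f : R -> R) (n : nat) :
  (forall t, continuous f t) ->
  is_RInt (fun t => f t * cos t ^ n) 0 (PI / 2) (cos_moment f n).
Proof.
intros Hf; apply (RInt_correct (V := R_CompleteNormedModule)).
apply (ex_RInt_continuous (V := R_CompleteNormedModule)); intros t _.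
apply (continuous_mult f); [apply Hf|].
apply (ex_derive_continuous (fun t => cos t ^ n)); auto_derive; exact I.
Qed.

Lemma cos_moment_plus (f g : R -> R) (n : nat) :
  (forall t, continuous f t) -> (forall t, continuous g t) ->
  cos_moment (fun t => f t + g t) n = cos_moment f n + cos_moment g n.
Proof.
intros Hf Hg; apply is_RInt_unique.
apply is_RInt_ext with (fun t => plus (f t * cos t ^ n) (g t * cos t ^ n)).
{ intros t _; unfold plus; simpl; ring. }
apply (is_RInt_plus (V := R_NormedModule)); now apply cos_moment_is_RInt.
Qed.

Lemma cos_moment_scal (c : R) (f : R -> R) (n : nat) :
  (forall t, continuous f t) ->
  cos_moment (fun t => c * f t) n = c * cos_moment f n.
Proof.
intros Hf; apply is_RInt_unique.
apply is_RInt_ext with (fun t => scal c (f t * cos t ^ n)).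
{ intros t _; unfold scal; simpl; unfold mult; simpl; ring. }
apply (is_RInt_scal (V := R_NormedModule)); now apply cos_moment_is_RInt.
Qed.

(* Green's identity: the integrand is the derivative of [f' g - f g'] for [g = cos ^ (n + 2)]. *)
Lemma cos_moment_rec (f f1 f2 : R -> R) (n : nat) :
  (forall t, is_derive f t (f1 t)) -> (forall t, is_derive f1 t (f2 t)) ->
  (forall t, continuous f2 t) -> f1 0 = 0 ->
  INR (n + 2) ^ 2 * cos_moment f (n + 2) + cos_moment f2 (n + 2)
  = INR (n + 2) * INR (n + 1) * cos_moment f n.
Proof.
intros H1 H2 Hc2 H0.
assert (Hc : forall t, continuous f t) 
  by (intros t; apply (ex_derive_continuous f); eexists; apply H1).
pose (F := fun t => f1 t * cos t ^ (n + 2) + INR (n + 2) * f t * cos t ^ (n + 1) * sin t).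
pose (dF := fun t => INR (n + 2) ^ 2 * (f t * cos t ^ (n + 2)) + f2 t * cos t ^ (n + 2)
   + (- (INR (n + 2) * INR (n + 1)) * (f t * cos t ^ n))).
assert (HdF : forall t, continuous dF t).
{ assert (Hp : forall k t, continuous (fun t => cos t ^ k) t).
  { intros k t; apply (ex_derive_continuous (fun t => cos t ^ k)); auto_derive; exact I. }
  intros t; unfold dF.
  apply (continuous_plus (V := R_NormedModule));
    [apply (continuous_plus (V := R_NormedModule))|].
  - apply (continuous_mult (fun _ => INR (n + 2) ^ 2)); [apply continuous_const|].
    apply (continuous_mult f); auto.
  - apply (continuous_mult f2); auto.
  - apply (continuous_mult (fun _ => - (INR (n + 2) * INR (n + 1)))); [apply continuous_const|].
    apply (continuous_mult f); auto. }
assert (HF : is_RInt dF 0 (PI / 2) (minus (F (PI / 2)) (F 0))).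
{ apply (is_RInt_derive F); [|auto].
  intros t _; unfold F, dF.
  auto_derive.
  - split; [exists (f2 t); apply H2|]; split; [exists (f1 t); apply H1 | exact I].
  - replace (Derive (fun x => f x) t) with (f1 t)
      by (symmetry; apply is_derive_unique, H1).
    replace (Derive (fun x => f1 x) t) with (f2 t)
      by (symmetry; apply is_derive_unique, H2).
    replace (n + 2)%nat with (S (S n)) by lia.
    replace (n + 1)%nat with (S n) by lia; simpl pred.
    replace (cos t ^ S (S n)) with (cos t * cos t * cos t ^ n) by (simpl; ring).
    replace (cos t ^ S n) with (cos t * cos t ^ n) by (simpl; ring).
    generalize (sin2_cos2 t); unfold Rsqr; intros E.
    replace (INR (S (S n))) with (INR (S n) + 1) by (rewrite (S_INR (S n)); ring).
    (* The two expressions agree only modulo [sin^2 + cos^2 = 1], so their difference is displayed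
       as a multiple of that relation. *)
    apply Rminus_diag_uniq.
    match goal with |- ?u = 0 => replace u with
      (- ((INR (S n) + 1) * INR (S n) * f t * cos t ^ n) * (sin t * sin t + cos t * cos t - 1))
      by ring end.
    rewrite E; ring. }
(* At pi/2 both parts of [F] contain a positive power of the cosine; at 0 they vanish through
   [f1 0 = 0] and [sin 0 = 0]. *)
replace (minus (F (PI / 2)) (F 0)) with 0 in HF.
2:{ unfold F, minus, plus, opp; simpl; rewrite H0, sin_0, cos_PI2.
    replace (n + 2)%nat with (S (S n)) by lia.
    replace (n + 1)%nat with (S n) by lia; simpl; ring. }
apply (is_RInt_unique (V := R_CompleteNormedModule)) in HF.
assert (HF' : RInt dF 0 (PI / 2) = INR (n + 2) ^ 2 * cos_moment f (n + 2)
  + cos_moment f2 (n + 2) + - (INR (n + 2) * INR (n + 1)) * cos_moment f n).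
{ apply is_RInt_unique; unfold dF.
  apply (is_RInt_plus (V := R_NormedModule)); [apply (is_RInt_plus (V := R_NormedModule))|].
  - apply (is_RInt_scal (V := R_NormedModule)); now apply cos_moment_is_RInt.
  - now apply cos_moment_is_RInt.
  - apply (is_RInt_scal (V := R_NormedModule)); now apply cos_moment_is_RInt. }
rewrite HF in HF'; lra.
Qed.

Definition wallis (m : nat) : R := cos_moment (fun _ => 1) (2 * m).

Lemma wallis_S (m : nat) :
  INR (2 * m + 2) * wallis (S m) = INR (2 * m + 1) * wallis m.
Proof.
assert (H : INR (2 * m + 2) ^ 2 * wallis (S m) = INR (2 * m + 2) * INR (2 * m + 1) * wallis m).
{ unfold wallis; rewrite <- (cos_moment_rec (fun _ => 1) (fun _ => 0) (fun _ => 0) (2 * m)).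
  - replace (2 * S m)%nat with (2 * m + 2)%nat by lia.
    assert (H0 : cos_moment (fun _ => 0 * 1) (2 * m + 2) = 0).
    { rewrite (cos_moment_scal 0 (fun _ => 1)), Rmult_0_l; [reflexivity|].
      intros; apply continuous_const. }
    rewrite Rmult_0_l in H0; rewrite H0; ring.
  - intros t; apply (is_derive_const (V := R_NormedModule)).
  - intros t; apply (is_derive_const (V := R_NormedModule)).
  - intros t; apply continuous_const.
  - reflexivity. }
assert (Hn : INR (2 * m + 2) <> 0) by (apply not_0_INR; lia).
apply Rmult_eq_reg_l with (INR (2 * m + 2)); [|exact Hn].
rewrite <- !Rmult_assoc, <- H; ring.
Qed.

Lemma wallis_0 : wallis 0 = PI / 2.
Proof.
unfold wallis, cos_moment; apply is_RInt_unique.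
apply is_RInt_ext with (fun _ => 1); [intros; simpl; ring|].
replace (PI / 2) with (scal (PI / 2 - 0) 1) at 2
  by (unfold scal; simpl; unfold mult; simpl; ring).
apply (is_RInt_const (V := R_NormedModule)).
Qed.

Lemma wallis_pos (m : nat) : 0 < wallis m.
Proof.
induction m as [|m IH]; [rewrite wallis_0; generalize PI_RGT_0; lra|].
assert (H1 : 0 < INR (2 * m + 1)) by (apply lt_0_INR; lia).
assert (H2 : 0 < INR (2 * m + 2)) by (apply lt_0_INR; lia).
generalize (wallis_S m); intros H.
apply Rmult_lt_reg_l with (INR (2 * m + 2)); [exact H2|].
rewrite H, Rmult_0_r; now apply Rmult_lt_0_compat.
Qed.

(** A crude Jordan inequality. From [t cos t <= sin t]: either [cos t >= 1/2] and [t <= 2 sin t], or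
    [sin t >= 1/2] and [t <= pi/2 <= 2]. *)
Lemma le_4_sin (t : R) : 0 <= t <= PI / 2 -> 0 <= t <= 4 * sin t.
Proof.
intros Ht; split; [tauto|].
assert (Hs : 0 <= sin t) by (apply sin_ge_0; generalize PI_RGT_0; lra).
assert (H : t * cos t <= sin t).
{ destruct (MVT_gen (fun u => sin u - u * cos u) 0 t (fun u => u * sin u)) as [c [Hc E]].
  - intros u _; auto_derive; [exact I | ring].
  - intros u _; apply derivable_continuous_pt.
    apply ex_derive_Reals_0; auto_derive; exact I.
  - rewrite Rmin_left, Rmax_right in Hc by lra.
    rewrite sin_0 in E.
    assert (0 <= sin c) by (apply sin_ge_0; generalize PI_RGT_0; lra).
    assert (0 <= c * sin c * (t - 0)) by (apply Rmult_le_pos; [apply Rmult_le_pos|]; lra).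
    lra. }
destruct (Rle_lt_dec (1 / 2) (cos t)) as [Hc|Hc]; [nra|].
assert (Hc0 : 0 <= cos t) by (apply cos_ge_0; lra).
generalize (sin2_cos2 t); unfold Rsqr; intros E.
assert (1 / 2 <= sin t) by nra.
generalize PI_4; lra.
Qed.

(** A double zero at 0 gives [|f t| <= M t^2] by two mean value steps, [M] being the maximum of
    [|f2|]; then [t <= 4 sin t]. The bound is phrased with [sin^2] because its moments are
    differences of Wallis integrals. *)
Lemma sin2_bound (f f1 f2 : R -> R) :
  (forall t, is_derive f t (f1 t)) -> (forall t, is_derive f1 t (f2 t)) ->
  (forall t, continuous f2 t) -> f 0 = 0 -> f1 0 = 0 ->
  exists C, 0 <= C /\ forall t, 0 <= t <= PI / 2 -> Rabs (f t) <= C * sin t ^ 2.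
Proof.
intros H1 H2 Hc Hf Hf1.
assert (HP : 0 <= PI / 2) by (generalize PI_RGT_0; lra).
destruct (continuity_ab_maj (fun t => Rabs (f2 t)) 0 (PI / 2) HP) as [tm [Hm _]].
{ intros t _; apply continuity_pt_filterlim.
  apply (continuous_comp f2 Rabs); [apply Hc | apply continuous_Rabs]. }
set (M := Rabs (f2 tm)) in *; assert (HM : 0 <= M) by apply Rabs_pos.
assert (B1 : forall t, 0 <= t <= PI / 2 -> Rabs (f1 t) <= M * t).
{ intros t Ht.
  destruct (MVT_gen f1 0 t f2) as [c [Hc1 E]].
  - intros; apply H2.
  - intros u _; apply continuity_pt_filterlim, (ex_derive_continuous f1); eexists; apply H2.
  - rewrite Rmin_left, Rmax_right in Hc1 by lra.
    rewrite Hf1, !Rminus_0_r in E; rewrite E, Rabs_mult, (Rabs_pos_eq t) by lra.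
    apply Rmult_le_compat_r; [lra|]; apply Hm; lra. }
exists (16 * M); split; [lra|]; intros t Ht.
assert (B0 : Rabs (f t) <= M * t * t).
{ destruct (MVT_gen f 0 t f1) as [c [Hc1 E]].
  - intros; apply H1.
  - intros u _; apply continuity_pt_filterlim, (ex_derive_continuous f); eexists; apply H1.
  - rewrite Rmin_left, Rmax_right in Hc1 by lra.
    rewrite Hf, !Rminus_0_r in E; rewrite E, Rabs_mult, (Rabs_pos_eq t) by lra.
    apply Rmult_le_compat_r; [lra|].
    eapply Rle_trans; [apply B1; lra|]; apply Rmult_le_compat_l; lra. }
pose proof (le_4_sin t Ht) as Hs.
assert (t * t <= 4 * sin t * (4 * sin t)) by (apply Rmult_le_compat; lra).
nra.
Qed.

(* [cos ^ (2 m)] concentrates at 0. *)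
Lemma cos_moment_le_wallis (f : R -> R) (C : R) (m : nat) :
  (forall t, continuous f t) ->
  (forall t, 0 <= t <= PI / 2 -> Rabs (f t) <= C * sin t ^ 2) ->
  INR (2 * m + 2) * Rabs (cos_moment f (2 * m)) <= C * wallis m.
Proof.
intros Hc HC.
assert (HP : 0 <= PI / 2) by (generalize PI_RGT_0; lra).
(* Since [sin^2 cos^(2m) = cos^(2m) - cos^(2m+2)], the majorant integrates exactly; [wallis_S] then
   says that [2 m + 2] times this difference is [wallis m]. *)
assert (HI : Rabs (cos_moment f (2 * m)) <= C * (wallis m - wallis (S m))).
{ assert (HR : is_RInt (fun t => C * (1 * cos t ^ (2 * m) - 1 * cos t ^ (2 * S m))) 0 (PI / 2)
    (C * (wallis m - wallis (S m)))).
  { apply (is_RInt_scal (V := R_NormedModule)), (is_RInt_minus (V := R_NormedModule));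
      apply (cos_moment_is_RInt (fun _ => 1)); intros; apply continuous_const. }
  refine (norm_RInt_le (V := R_NormedModule) (fun t => f t * cos t ^ (2 * m)) _ 0 (PI / 2) _ _
    HP _ (cos_moment_is_RInt f (2 * m) Hc) HR).
  intros t Ht; change (Rabs (f t * cos t ^ (2 * m))
    <= C * (1 * cos t ^ (2 * m) - 1 * cos t ^ (2 * S m))).
  replace (2 * S m)%nat with (S (S (2 * m))) by lia.
  assert (Hp : 0 <= cos t ^ (2 * m)) by (rewrite pow_mult; apply pow_le, pow2_ge_0).
  rewrite Rabs_mult, (Rabs_pos_eq (cos t ^ (2 * m))) by exact Hp.
  replace (C * (1 * cos t ^ (2 * m) - 1 * cos t ^ S (S (2 * m))))
    with (C * (1 - cos t * cos t) * cos t ^ (2 * m)) by (simpl pow; ring).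
  apply Rmult_le_compat_r; [exact Hp|].
  generalize (sin2_cos2 t); unfold Rsqr; intros E.
  replace (1 - cos t * cos t) with (sin t ^ 2) by (simpl; lra).
  now apply HC. }
apply Rmult_le_compat_l with (r := INR (2 * m + 2)) in HI; [|apply pos_INR].
eapply Rle_trans; [exact HI|]; right.
generalize (wallis_S m); rewrite (plus_INR (2 * m) 2), (plus_INR (2 * m) 1).
simpl (INR 2); simpl (INR 1); intros E.
replace ((INR (2 * m) + (1 + 1)) * (C * (wallis m - wallis (S m))))
  with (C * ((INR (2 * m) + (1 + 1)) * wallis m - (INR (2 * m) + (1 + 1)) * wallis (S m)))
  by ring.
rewrite E; ring.
Qed.

Lemma cos_moment_0_derive (F f : R -> R) :
  (forall t, is_derive F t (f t)) -> (forall t, continuous f t) ->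
  cos_moment f 0 = F (PI / 2) - F 0.
Proof.
intros HF Hf; apply is_RInt_unique.
apply is_RInt_ext with f; [intros; simpl; symmetry; apply Rmult_1_r|].
apply (is_RInt_derive (V := R_CompleteNormedModule) F); auto.
Qed.

(* Real and imaginary parts of [cos (2 (x + i y) t)]. *)
Definition re_cos (x y t : R) : R := cos (2 * x * t) * cosh (2 * y * t).
Definition im_cos (x y t : R) : R := - (sin (2 * x * t) * sinh (2 * y * t)).

Definition re_cos' (x y t : R) : R :=
  - (2 * x) * (sin (2 * x * t) * cosh (2 * y * t))
  + 2 * y * (cos (2 * x * t) * sinh (2 * y * t)).
Definition im_cos' (x y t : R) : R :=
  - (2 * x) * (cos (2 * x * t) * sinh (2 * y * t))
  - 2 * y * (sin (2 * x * t) * cosh (2 * y * t)).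

(** [4 (x x - y y)] and [8 x y] are the real and imaginary parts of [4 z^2]: together with
    [im_cos''] this is the equation [f'' = - 4 z^2 f], kept in a form linear in [re_cos] and
    [im_cos]. *)
Definition re_cos'' (x y t : R) : R :=
  - (4 * (x * x - y * y)) * re_cos x y t + 8 * x * y * im_cos x y t.
Definition im_cos'' (x y t : R) : R :=
  - (4 * (x * x - y * y)) * im_cos x y t + - (8 * x * y) * re_cos x y t.

Lemma re_cos_derive (x y t : R) : is_derive (re_cos x y) t (re_cos' x y t).
Proof. unfold re_cos, re_cos', cosh, sinh; auto_derive; [exact I | field]. Qed.

Lemma im_cos_derive (x y t : R) : is_derive (im_cos x y) t (im_cos' x y t).
Proof. unfold im_cos, im_cos', cosh, sinh; auto_derive; [exact I | field]. Qed.

Lemma re_cos'_derive (x y t : R) : is_derive (re_cos' x y) t (re_cos'' x y t).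
Proof.
unfold re_cos', re_cos'', re_cos, im_cos, cosh, sinh; auto_derive; [exact I | field].
Qed.

Lemma im_cos'_derive (x y t : R) : is_derive (im_cos' x y) t (im_cos'' x y t).
Proof.
unfold im_cos', im_cos'', re_cos, im_cos, cosh, sinh; auto_derive; [exact I | field].
Qed.

Lemma re_cos_continuous (x y t : R) : continuous (re_cos x y) t.
Proof. apply (ex_derive_continuous (re_cos x y)); eexists; apply re_cos_derive. Qed.

Lemma im_cos_continuous (x y t : R) : continuous (im_cos x y) t.
Proof. apply (ex_derive_continuous (im_cos x y)); eexists; apply im_cos_derive. Qed.

Lemma continuous_scal_re_im (a b x y t : R) :
  continuous (fun t => a * re_cos x y t) t /\
  continuous (fun t => b * im_cos x y t) t.
Proof.
split.
- apply (continuous_mult (fun _ => a)); [apply continuous_const | apply re_cos_continuous].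
- apply (continuous_mult (fun _ => b)); [apply continuous_const | apply im_cos_continuous].
Qed.

Lemma re_cos''_continuous (x y t : R) : continuous (re_cos'' x y) t.
Proof.
(* Using one half of the conjunction leaves the coefficient of the other half open; [0] fills it. *)
apply (continuous_plus (V := R_NormedModule)); apply continuous_scal_re_im; exact 0.
Qed.

Lemma im_cos''_continuous (x y t : R) : continuous (im_cos'' x y) t.
Proof.
apply (continuous_plus (V := R_NormedModule)); apply continuous_scal_re_im; exact 0.
Qed.

Lemma cos_moment_lin (a b x y : R) (n : nat) :
  cos_moment (fun t => a * re_cos x y t + b * im_cos x y t) n
  = a * cos_moment (re_cos x y) n + b * cos_moment (im_cos x y) n.
Proof.
rewrite cos_moment_plus by (intros; apply continuous_scal_re_im; exact 0).
now rewrite !cos_moment_scal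
  by (intros; apply re_cos_continuous || apply im_cos_continuous).
Qed.

Lemma cos_moment_lin' (a b x y : R) (n : nat) :
  cos_moment (fun t => a * im_cos x y t + b * re_cos x y t) n
  = a * cos_moment (im_cos x y) n + b * cos_moment (re_cos x y) n.
Proof.
rewrite cos_moment_plus by (intros; apply continuous_scal_re_im; exact 0).
now rewrite !cos_moment_scal
  by (intros; apply re_cos_continuous || apply im_cos_continuous).
Qed.

End CosineMoments.

(** * Complex cosine moments and the partial sine products *)

Definition Ccos_moment (z : CC) (m : nat) : CC :=
  (cos_moment (re_cos (Re z) (Im z)) (2 * m), cos_moment (im_cos (Re z) (Im z)) (2 * m)).

Lemma Ccos_moment_S (z : CC) (m : nat) :
  (RtoC (INR (2 * m + 2)) ^ 2 - 4 * z ^ 2) * Ccos_moment z (S m)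
  = RtoC (INR (2 * m + 2)) * RtoC (INR (2 * m + 1)) * Ccos_moment z m.
Proof.
destruct z as [x y]; unfold Ccos_moment, Re, Im; simpl fst; simpl snd.
pose proof (cos_moment_rec (re_cos x y) (re_cos' x y) (re_cos'' x y) (2 * m)
  (re_cos_derive x y) (re_cos'_derive x y) (re_cos''_continuous x y)
  ltac:(unfold re_cos', sinh; rewrite !Rmult_0_r, sin_0, Ropp_0; field)) as Hp.
pose proof (cos_moment_rec (im_cos x y) (im_cos' x y) (im_cos'' x y) (2 * m)
  (im_cos_derive x y) (im_cos'_derive x y) (im_cos''_continuous x y)
  ltac:(unfold im_cos', sinh; rewrite !Rmult_0_r, sin_0, Ropp_0; field)) as Hq.
unfold re_cos'' in Hp; rewrite cos_moment_lin in Hp.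
unfold im_cos'' in Hq; rewrite cos_moment_lin' in Hq.
replace (2 * S m)%nat with (2 * m + 2)%nat by lia.
set (n2 := INR (2 * m + 2)) in *; set (n1 := INR (2 * m + 1)) in *.
set (P := cos_moment (re_cos x y) (2 * m + 2)) in *.
set (Q := cos_moment (im_cos x y) (2 * m + 2)) in *.
apply injective_projections; simpl.
- transitivity (n2 * n1 * cos_moment (re_cos x y) (2 * m))%R; [rewrite <- Hp; ring|].
  simpl; ring.
- transitivity (n2 * n1 * cos_moment (im_cos x y) (2 * m))%R; [rewrite <- Hq; ring|].
  simpl; ring.
Qed.

Lemma Csin_components (x y : R) :
  Csin (x, y) = ((sin x * cosh y)%R, (cos x * sinh y)%R).
Proof.
assert (E : / (2 * Ci) = (0, - / 2)%R).
{ apply injective_projections; simpl; field. }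
unfold Csin, Cdiv; rewrite E.
apply injective_projections; unfold Cexp, Re, Im, cosh, sinh; simpl;
  replace (0 * x - 1 * y)%R with (- y)%R by ring;
  replace (0 * y + 1 * x)%R with x by ring;
  rewrite ?cos_neg, ?sin_neg, ?Ropp_involutive; field.
Qed.

(** The antiderivative of [2 z cos(2 z t)] is [sin(2 z t)], treated by components. Keeping [2 z] on
    the left includes [z = 0]. *)
Lemma Ccos_moment_0 (z : CC) : 2 * z * Ccos_moment z 0 = Csin (RtoC PI * z).
Proof.
destruct z as [x y]; unfold Ccos_moment, Re, Im; simpl fst; simpl snd.
assert (Hr : (2 * x * cos_moment (re_cos x y) 0 + - (2 * y) * cos_moment (im_cos x y) 0
  = sin (PI * x) * cosh (PI * y))%R).
{ rewrite <- cos_moment_lin.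
  rewrite (cos_moment_0_derive (fun t => sin (2 * x * t) * cosh (2 * y * t))%R).
  - rewrite Rmult_0_r, sin_0, Rmult_0_l, Rminus_0_r; f_equal; f_equal; field.
  - intros t; unfold re_cos, im_cos, cosh, sinh; auto_derive; [exact I | field].
  - intros t; apply (continuous_plus (V := R_NormedModule));
      apply continuous_scal_re_im; exact 0%R. }
assert (Hi : (2 * x * cos_moment (im_cos x y) 0 + 2 * y * cos_moment (re_cos x y) 0
  = cos (PI * x) * sinh (PI * y))%R).
{ rewrite <- cos_moment_lin'.
  rewrite (cos_moment_0_derive (fun t => cos (2 * x * t) * sinh (2 * y * t))%R).
  - rewrite !Rmult_0_r, sinh_0, Rmult_0_r, Rminus_0_r; f_equal; f_equal; field.
  - intros t; unfold re_cos, im_cos, cosh, sinh; auto_derive; [exact I | field].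
  - intros t; apply (continuous_plus (V := R_NormedModule));
      apply continuous_scal_re_im; exact 0%R. }
replace (RtoC PI * (x, y)) with ((PI * x)%R, (PI * y)%R)
  by (apply injective_projections; simpl; ring).
rewrite Csin_components, <- Hr, <- Hi.
apply injective_projections; simpl; ring.
Qed.

Lemma wallis_C_neq_0 (m : nat) : RtoC (wallis m) <> 0.
Proof. apply RtoC_neq_0; generalize (wallis_pos m); lra. Qed.

(** The real part minus 1 and the imaginary part of [cos(2 z t)] have double zeros at 0, so their
    moments are O([wallis m] / m). *)
Lemma Ccos_moment_div_wallis_Clim (z : CC) :
  Clim (fun m => Ccos_moment z m / RtoC (wallis m)) 1.
Proof.
destruct z as [x y].
destruct (sin2_bound (fun t => re_cos x y t + - (1))%R (re_cos' x y) (re_cos'' x y))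
  as [C1 [HC1 B1]].
{ intros t; rewrite <- (Rplus_0_r (re_cos' x y t)).
  apply (is_derive_plus (V := R_NormedModule)); [apply re_cos_derive|].
  apply (is_derive_const (V := R_NormedModule)). }
{ apply re_cos'_derive. }
{ apply re_cos''_continuous. }
{ unfold re_cos; rewrite !Rmult_0_r, cos_0, cosh_0; ring. }
{ unfold re_cos', sinh; rewrite !Rmult_0_r, sin_0, Ropp_0; field. }
destruct (sin2_bound (im_cos x y) (im_cos' x y) (im_cos'' x y)) as [C2 [HC2 B2]].
{ apply im_cos_derive. }
{ apply im_cos'_derive. }
{ apply im_cos''_continuous. }
{ unfold im_cos; rewrite !Rmult_0_r, sin_0; ring. }
{ unfold im_cos', sinh; rewrite !Rmult_0_r, sin_0, Ropp_0; field. }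
apply Clim_le_loc with (fun m => (C1 + C2) * / INR m)%R.
- exists 1%nat; intros m Hm.
  pose proof (wallis_pos m) as HW; pose proof (wallis_C_neq_0 m) as HW0.
  replace (Ccos_moment (x, y) m / RtoC (wallis m) - 1)
    with ((Ccos_moment (x, y) m - RtoC (wallis m)) / RtoC (wallis m)) by (field; auto).
  rewrite Cmod_div, (Cmod_R (wallis m)), (Rabs_pos_eq (wallis m)) by (auto; lra).
  apply Rmult_le_reg_r with (wallis m); [exact HW|].
  unfold Rdiv; rewrite Rmult_assoc, Rinv_l, Rmult_1_r by lra.
  eapply Rle_trans; [apply Cmod_le_Rabs|].
  assert (HK : cos_moment (fun t => re_cos x y t + - (1))%R (2 * m)
    = (cos_moment (re_cos x y) (2 * m) + - wallis m)%R).
  { rewrite cos_moment_plus;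
      [| apply re_cos_continuous | intros; apply continuous_const].
    f_equal; unfold wallis.
    replace (- cos_moment (fun _ => 1) (2 * m))%R
      with (-1 * cos_moment (fun _ => 1) (2 * m))%R by ring.
    rewrite <- cos_moment_scal by (intros; apply continuous_const).
    f_equal; rewrite Rmult_1_r; reflexivity. }
  pose proof (cos_moment_le_wallis (fun t => re_cos x y t + - (1))%R C1 m
    ltac:(intros t; apply (continuous_plus (V := R_NormedModule));
          [apply re_cos_continuous | apply continuous_const]) B1) as M1.
  pose proof (cos_moment_le_wallis _ C2 m (im_cos_continuous x y) B2) as M2.
  rewrite HK in M1.
  replace (Re (Ccos_moment (x, y) m - RtoC (wallis m)))
    with (cos_moment (re_cos x y) (2 * m) + - wallis m)%R by reflexivity.
  replace (Im (Ccos_moment (x, y) m - RtoC (wallis m)))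
    with (cos_moment (im_cos x y) (2 * m))
    by (unfold Im; simpl; ring).
  assert (Hm0 : (0 < INR m)%R) by (apply lt_0_INR; lia).
  assert (Hle : (INR m <= INR (2 * m + 2))%R) by (apply le_INR; lia).
  apply Rmult_le_reg_l with (INR m); [exact Hm0|].
  replace (INR m * ((C1 + C2) * / INR m * wallis m))%R
    with (C1 * wallis m + C2 * wallis m)%R by (field; lra).
  rewrite Rmult_plus_distr_l.
  apply Rplus_le_compat; (eapply Rle_trans; [|eassumption]);
    (apply Rmult_le_compat_r; [apply Rabs_pos | exact Hle]).
- replace (Finite 0) with (Finite ((C1 + C2) * 0)) by (f_equal; ring).
  apply is_lim_seq_mult'; [apply is_lim_seq_const | apply lim_seq_inv_INR].
Qed.

(** This is [z] times the product of [1 - z^2 / k^2] over k = 1, ..., m, the partial Euler product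
    of sin(pi z) / pi. *)
Definition sine_prod (z : CC) (m : nat) : CC :=
  poch z (S m) * poch (1 - z) m / RtoC (INR (fact m)) ^ 2.

(** The left side does not depend on m: one step multiplies the product by [1 - z^2 / (m+1)^2], and
    the two moment recurrences divide the quotient by the same factor. The value is read off at m =
    0. *)
Lemma sine_prod_mul_moment (z : CC) (m : nat) :
  sine_prod z m * (Ccos_moment z m / RtoC (wallis m)) = Csin (RtoC PI * z) / RtoC PI.
Proof.
assert (HPI : RtoC PI <> 0) by (apply RtoC_neq_0, PI_neq0).
assert (H2 : RtoC 2 <> 0) by (apply RtoC_neq_0; lra).
induction m as [|m IH].
- rewrite wallis_0, <- Ccos_moment_0, RtoC_div by lra.
  unfold sine_prod; simpl; field; auto.
- rewrite <- IH.
  pose proof (wallis_C_neq_0 (S m)) as W1.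
  pose proof (RtoC_fact_neq_0 m) as F0; pose proof (INR_S_C_neq_0 m) as N0.
  assert (Hn : RtoC (INR (2 * m + 2)) = 2 * (RtoC (INR m) + 1)).
  { rewrite plus_INR, mult_INR, RtoC_plus, RtoC_mult; simpl.
    replace (RtoC (1 + 1)) with (RtoC 2) by (f_equal; ring); ring. }
  assert (Hk0 : RtoC (INR (2 * m + 1)) <> 0) by (apply RtoC_INR_neq_0; lia).
  assert (EW : RtoC (wallis m)
    = 2 * (RtoC (INR m) + 1) * RtoC (wallis (S m)) / RtoC (INR (2 * m + 1))).
  { rewrite <- Hn, <- RtoC_mult, wallis_S, RtoC_mult; field; exact Hk0. }
  (* The recurrence is solved for index m, not m + 1: the coefficient of [Ccos_moment z (S m)] is
     zero when [z] is m + 1 or its opposite. *)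
  assert (EJ : Ccos_moment z m
    = ((2 * (RtoC (INR m) + 1)) ^ 2 - 4 * z ^ 2) * Ccos_moment z (S m)
      / (2 * (RtoC (INR m) + 1) * RtoC (INR (2 * m + 1)))).
  { rewrite <- Hn, Ccos_moment_S; field; split; [exact Hk0|].
    rewrite Hn; now apply Cmult_neq_0. }
  rewrite EW, EJ; unfold sine_prod.
  rewrite (poch_S z (S m)), (poch_S (1 - z) m), fact_simpl, mult_INR, RtoC_mult, !RtoC_INR_S.
  field; repeat split; auto.
Qed.

Lemma sine_prod_Clim (z : CC) : Clim (sine_prod z) (Csin (RtoC PI * z) / RtoC PI).
Proof.
pose proof (Ccos_moment_div_wallis_Clim z) as H.
pose proof (Clim_scal (Csin (RtoC PI * z) / RtoC PI) _ _ (Clim_inv _ _ C1_nz H)) as K.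
replace (Csin (RtoC PI * z) / RtoC PI * / 1) with (Csin (RtoC PI * z) / RtoC PI) in K
  by (field; apply RtoC_neq_0, PI_neq0).
revert K; apply Clim_ext_loc.
destruct (Clim_eventually _ _ 1 H Rlt_0_1) as [N HN].
exists N; intros m Hm; specialize (HN m Hm).
rewrite <- (sine_prod_mul_moment z m).
set (r := Ccos_moment z m / RtoC (wallis m)) in *.
assert (Hr : r <> 0).
{ intros E; rewrite E in HN; replace (0 - 1) with (- (1)) in HN by ring.
  rewrite Cmod_m1 in HN; lra. }
field; exact Hr.
Qed.

(** * The reflection formula *)

(** Approximates 1 / Gamma(z). The Pochhammer symbol stands in the numerator, so the poles of Gamma
    become zeros and can be treated like other points. *)
Definition recip_gauss (z : CC) (n : nat) : CC :=
  poch z (S n) / (RtoC (INR (fact n)) * Cpowr (INR n) z).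

Lemma recip_gauss_mul_gauss (z : CC) (n : nat) :
  (forall k : nat, z <> - RtoC (INR k)) -> recip_gauss z n * gauss_term z n = 1.
Proof.
intros Hz; unfold recip_gauss, gauss_term; field.
repeat split; [now apply poch_neq_0 | apply Cpowr_neq_0 | apply RtoC_fact_neq_0].
Qed.

Lemma RtoC_PI_neq_0 : RtoC PI <> 0.
Proof. apply RtoC_neq_0, PI_neq0. Qed.

(** Since [n^z n^(1-z) = n], the product equals [sine_prod z n * (1 - z + n) / n], for every [z]. *)
Lemma recip_gauss_reflect_Clim (z : CC) :
  Clim (fun n => recip_gauss z n * recip_gauss (1 - z) n) (Csin (RtoC PI * z) / RtoC PI).
Proof.
pose proof (Clim_mult _ _ _ _ (sine_prod_Clim z)
  (Clim_inv _ _ C1_nz (Clim_INR_div_add (1 - z)))) as H.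
replace (Csin (RtoC PI * z) / RtoC PI * / 1) with (Csin (RtoC PI * z) / RtoC PI) in H
  by (field; apply RtoC_PI_neq_0).
revert H; apply Clim_ext_loc.
destruct (INR_unbounded (Cmod (1 - z))) as [N HN].
exists (S N); intros n Hn.
assert (HNn : (INR N <= INR n)%R) by (apply le_INR; lia).
assert (H0 : RtoC (INR n) <> 0) by (apply RtoC_INR_neq_0; lia).
assert (H1 : 1 - z + RtoC (INR n) <> 0).
{ apply Cmod_gt_0; eapply Rlt_le_trans; [|apply Cmod_add_INR_ge]; lra. }
assert (HP : Cpowr (INR n) (1 - z) = RtoC (INR n) / Cpowr (INR n) z).
{ rewrite <- (Cpowr_1 (INR n)) by (apply lt_0_INR; lia).
  replace (RtoC 1) with (1 - z + z) at 2 by ring.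
  rewrite Cpowr_plus; field; apply Cpowr_neq_0. }
unfold recip_gauss, sine_prod; rewrite HP, (poch_S (1 - z) n).
field; repeat split; auto using Cpowr_neq_0, RtoC_fact_neq_0.
Qed.

Lemma recip_gauss_Clim (z : CC) :
  (forall k : nat, z <> - RtoC (INR k)) ->
  Clim (recip_gauss (1 - z)) (Csin (RtoC PI * z) / RtoC PI * CGamma z).
Proof.
intros Hz.
pose proof (Clim_mult _ _ _ _ (recip_gauss_reflect_Clim z) (gauss_term_Clim z Hz)) as H.
revert H; apply Clim_ext; intros n.
transitivity (recip_gauss z n * gauss_term z n * recip_gauss (1 - z) n); [ring|].
rewrite recip_gauss_mul_gauss by assumption; ring.
Qed.

Lemma CGamma_reflection (z : CC) :
  (forall k : nat, z <> - RtoC (INR k)) -> (forall k : nat, 1 - z <> - RtoC (INR k)) ->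
  Csin (RtoC PI * z) / RtoC PI * CGamma z * CGamma (1 - z) = 1.
Proof.
intros Hz Hz1.
apply Clim_unique with (fun n => recip_gauss (1 - z) n * gauss_term (1 - z) n).
- apply Clim_mult; [now apply recip_gauss_Clim | now apply gauss_term_Clim].
- apply Clim_ext with (fun _ => 1); [|apply Clim_const].
  intros n; now rewrite recip_gauss_mul_gauss.
Qed.

Lemma half_nonpole (k : nat) : RtoC (/ 2) <> - RtoC (INR k).
Proof.
rewrite <- RtoC_opp; intros H; apply RtoC_inj in H; generalize (pos_INR k); lra.
Qed.

Lemma gauss_half_nonneg (n : nat) :
  exists r : R, (0 <= r)%R /\ gauss_term (RtoC (/ 2)) n = RtoC r.
Proof.
assert (Hp : forall n, exists p : R, (0 < p)%R /\ poch (RtoC (/ 2)) n = RtoC p).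
{ intros m; induction m as [|m [p [Hp E]]]; [exists 1%R; split; [lra | reflexivity]|].
  exists (p * (/ 2 + INR m))%R; split.
  - apply Rmult_lt_0_compat; [exact Hp | generalize (pos_INR m); lra].
  - now rewrite poch_S, E, RtoC_mult, RtoC_plus. }
destruct (Hp (S n)) as [p [Hp0 E]].
exists (INR (fact n) * exp (/ 2 * ln (INR n)) / p)%R; split.
- apply Rmult_le_pos; [apply Rmult_le_pos|]; [apply pos_INR | left; apply exp_pos |].
  left; now apply Rinv_0_lt_compat.
- unfold gauss_term, Cpowr; rewrite E, <- RtoC_mult, Cexp_RtoC.
  now rewrite RtoC_div, RtoC_mult by lra.
Qed.

(** Reflection at 1/2 gives the square, pi. The root [- sqrt PI] is excluded because the Gauss
    products there are nonnegative reals and stay at distance at least [sqrt PI] from it. *)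
Lemma CGamma_half : CGamma (RtoC (/ 2)) = RtoC (sqrt PI).
Proof.
assert (HS : (0 < sqrt PI)%R) by (apply sqrt_lt_R0, PI_RGT_0).
assert (E1 : 1 - RtoC (/ 2) = RtoC (/ 2)).
{ rewrite <- RtoC_minus; f_equal; field. }
assert (H : (CGamma (RtoC (/ 2)) - RtoC (sqrt PI)) * (CGamma (RtoC (/ 2)) + RtoC (sqrt PI)) = 0).
{ pose proof (CGamma_reflection (RtoC (/ 2)) half_nonpole) as H.
  rewrite E1 in H; specialize (H half_nonpole).
  rewrite <- RtoC_mult in H.
  change (RtoC (PI * / 2)) with ((PI / 2)%R, 0%R) in H.
  rewrite Csin_components, sin_PI2, cos_PI2, cosh_0, Rmult_1_l, Rmult_0_l in H.
  change (1%R, 0%R) with (RtoC 1) in H.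
  set (g := CGamma (RtoC (/ 2))) in *.
  replace ((g - RtoC (sqrt PI)) * (g + RtoC (sqrt PI)))
    with (RtoC PI * (1 / RtoC PI * g * g) - RtoC (sqrt PI) * RtoC (sqrt PI))
    by (field; apply RtoC_PI_neq_0).
  rewrite H, <- (RtoC_mult (sqrt PI)), sqrt_sqrt by (left; apply PI_RGT_0); ring. }
destruct (Ceq_dec (CGamma (RtoC (/ 2)) - RtoC (sqrt PI)) 0) as [E|E].
- now apply Ceq_minus.
- exfalso; apply (Cmult_neq_0 _ (CGamma (RtoC (/ 2)) + RtoC (sqrt PI))) in E; [tauto|].
  intros K.
  destruct (Clim_eventually _ _ _ (gauss_term_Clim _ half_nonpole) HS) as [N HN].
  specialize (HN N (le_n _)).
  destruct (gauss_half_nonneg N) as [r [Hr Er]].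
  rewrite Er in HN.
  replace (CGamma (RtoC (/ 2))) with (- RtoC (sqrt PI)) in HN
    by (replace (CGamma (RtoC (/ 2)))
          with (CGamma (RtoC (/ 2)) + RtoC (sqrt PI) - RtoC (sqrt PI)) by ring;
        rewrite K; ring).
  rewrite <- RtoC_opp, <- RtoC_minus, Cmod_R, Rabs_pos_eq in HN by lra; lra.
Qed.

(** * Evaluation of Bailey's product *)

(** The discrete duplication formula: it trades the [4 ^ N] of [bailey_prod] for a Gauss product at
    1/2. *)
Lemma poch_half (n : nat) :
  poch (RtoC (/ 2)) n * RtoC (4 ^ n) * RtoC (INR (fact n)) = RtoC (INR (fact (2 * n))).
Proof.
induction n as [|n IH]; [simpl; ring|].
replace (2 * S n)%nat with (S (S (2 * n))) by lia.
rewrite poch_S, !fact_simpl, !mult_INR, !RtoC_mult, <- IH, !RtoC_INR_S, mult_INR, RtoC_mult.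
replace (RtoC (4 ^ S n)) with (4 * RtoC (4 ^ n)) by (rewrite <- RtoC_mult; reflexivity).
simpl (INR 2); replace (RtoC (1 + 1)) with (RtoC 2) by (f_equal; ring).
rewrite RtoC_inv by lra.
field; apply RtoC_neq_0; lra.
Qed.

(** The indices [S n] and [2 * n + 1] are matched so that both sides contain the same
    [poch c (2 * S n)]. The powers of n combine through [(1 - z) + (1 - w) = c + 1/2], which leaves
    [(n / (2 n + 1))^c], the source of the power of 2 in the limit. *)
Lemma bailey_prod_eq (w z : CC) (n : nat) :
  let c := 1 - (w + z - RtoC (/ 2)) in
  (1 <= n)%nat ->
  (forall k : nat, c <> - RtoC (INR k)) ->
  bailey_prod (w - z + RtoC (/ 2)) c (S n) =
  2 * gauss_term (RtoC (/ 2)) n * (recip_gauss (1 - z) n * recip_gauss (1 - w) n)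
  * gauss_term c (2 * n + 1)
  * Cexp (c * RtoC (ln (INR n) - ln (INR (2 * n + 1)))).
Proof.
intros c Hn Hc; unfold bailey_prod.
assert (H2 : RtoC 2 <> 0) by (apply RtoC_neq_0; lra).
replace ((c + (w - z + RtoC (/ 2))) / 2) with (1 - z)
  by (unfold c; rewrite RtoC_inv by lra; field; auto).
replace ((c + 1 - (w - z + RtoC (/ 2))) / 2) with (1 - w)
  by (unfold c; rewrite RtoC_inv by lra; field; auto).
assert (HE : Cexp (c * RtoC (ln (INR n) - ln (INR (2 * n + 1))))
  = Cpowr (INR n) (1 - z) * Cpowr (INR n) (1 - w)
    / (Cpowr (INR n) (RtoC (/ 2)) * Cpowr (INR (2 * n + 1)) c)).
{ replace (Cpowr (INR n) (1 - z) * Cpowr (INR n) (1 - w))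
    with (Cpowr (INR n) c * Cpowr (INR n) (RtoC (/ 2))).
  - replace (c * RtoC (ln (INR n) - ln (INR (2 * n + 1))))
      with (c * RtoC (ln (INR n)) + - (c * RtoC (ln (INR (2 * n + 1)))))
      by (rewrite RtoC_minus; ring).
    rewrite Cexp_plus, Cexp_opp; unfold Cpowr; field; split; apply Cexp_neq_0.
  - rewrite <- !Cpowr_plus; f_equal; unfold c; rewrite RtoC_inv by lra; field; auto. }
(* The leading 2 is [(2n+2)! / (n+1)! = 2 (2n+1)! / n!]. *)
assert (HH : poch (RtoC (/ 2)) (S n)
  = 2 * RtoC (INR (fact (2 * n + 1))) / (RtoC (4 ^ S n) * RtoC (INR (fact n)))).
{ pose proof (poch_half (S n)) as P.
  replace (2 * S n)%nat with (S (2 * n + 1)) in P by lia.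
  rewrite (fact_simpl n), (fact_simpl (2 * n + 1)), !mult_INR, !RtoC_mult in P.
  replace (RtoC (INR (S (2 * n + 1)))) with (2 * RtoC (INR (S n))) in P.
  2:{ rewrite <- RtoC_mult; f_equal; replace (S (2 * n + 1)) with (2 * S n)%nat by lia.
      rewrite mult_INR; simpl (INR 2); ring. }
  pose proof (RtoC_INR_neq_0 (S n) ltac:(lia)) as HSn.
  pose proof (RtoC_fact_neq_0 n) as Hf.
  assert (H4 : RtoC (4 ^ S n) <> 0) by (apply RtoC_neq_0, pow_nonzero; lra).
  replace (2 * RtoC (INR (fact (2 * n + 1))))
    with (2 * RtoC (INR (S n)) * RtoC (INR (fact (2 * n + 1))) / RtoC (INR (S n)))
    by (field; exact HSn).
  rewrite <- P; field; auto. }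
rewrite HE; unfold gauss_term, recip_gauss; rewrite HH.
replace (S (2 * n + 1)) with (2 * S n)%nat by lia.
pose proof (poch_neq_0 c (2 * S n) Hc) as Hp.
pose proof (RtoC_fact_neq_0 n) as Hf.
pose proof (RtoC_fact_neq_0 (2 * n + 1)) as Hf2.
assert (H4 : RtoC (4 ^ S n) <> 0) by (apply RtoC_neq_0, pow_nonzero; lra).
field; repeat split; auto using Cpowr_neq_0.
Qed.

Lemma lim_ln_ratio :
  is_lim_seq (fun n => ln (INR n) - ln (INR (2 * n + 1)))%R (- ln 2)%R.
Proof.
apply is_lim_seq_ext_loc with (fun n => - ln (2 + / INR n))%R.
- exists 1%nat; intros n Hn.
  assert (H0 : (0 < INR n)%R) by (apply lt_0_INR; lia).
  replace (INR (2 * n + 1)) with (INR n * (2 + / INR n))%R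
    by (rewrite plus_INR, mult_INR; simpl; field; lra).
  rewrite ln_mult; [ring | exact H0 |].
  generalize (Rinv_0_lt_compat _ H0); lra.
- apply (is_lim_seq_opp _ (ln 2)), (is_lim_seq_continuous ln).
  + apply derivable_continuous_pt; exists (/ 2)%R; apply derivable_pt_lim_ln; lra.
  + replace (Finite 2) with (Finite (2 + 0)) by (f_equal; ring).
    apply is_lim_seq_plus'; [apply is_lim_seq_const | apply lim_seq_inv_INR].
Qed.

Lemma bailey_prod_Clim (w z : CC) :
  let c := 1 - (w + z - RtoC (/ 2)) in
  (forall k : nat, w <> - RtoC (INR k)) -> (forall k : nat, z <> - RtoC (INR k)) ->
  (forall k : nat, c <> - RtoC (INR k)) ->
  Clim (bailey_prod (w - z + RtoC (/ 2)) c)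
    (2 * RtoC (sqrt PI)
     * (Csin (RtoC PI * z) / RtoC PI * CGamma z * (Csin (RtoC PI * w) / RtoC PI * CGamma w))
     * CGamma c * Cexp (c * RtoC (- ln 2))).
Proof.
intros c Hw Hz Hc.
assert (H : Clim (fun n => bailey_prod (w - z + RtoC (/ 2)) c (S n))
  (2 * RtoC (sqrt PI)
   * (Csin (RtoC PI * z) / RtoC PI * CGamma z * (Csin (RtoC PI * w) / RtoC PI * CGamma w))
   * CGamma c * Cexp (c * RtoC (- ln 2)))).
{ rewrite <- CGamma_half.
  apply Clim_ext_loc with (fun n =>
    2 * gauss_term (RtoC (/ 2)) n * (recip_gauss (1 - z) n * recip_gauss (1 - w) n)
    * gauss_term c (2 * n + 1)
    * Cexp (c * RtoC (ln (INR n) - ln (INR (2 * n + 1))))).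
  - exists 1%nat; intros n Hn; symmetry; now apply bailey_prod_eq.
  - apply Clim_mult; [|apply Clim_Cexp_scal, lim_ln_ratio].
    apply Clim_mult.
    + apply Clim_mult.
      * apply Clim_scal, gauss_term_Clim, half_nonpole.
      * apply Clim_mult; now apply recip_gauss_Clim.
    + apply (Clim_subseq (gauss_term c)); [|now apply gauss_term_Clim].
      apply eventually_subseq; intros; lia. }
unfold Clim in *.
apply is_lim_seq_incr_1; exact H.
Qed.

(** * The summation formula *)

(** Gamma(s) = (s-1)...(s-n) Gamma(s-n), with every sign reversed to form [poch (1 - s) n]. As s is
    not an integer, the descent meets no pole. *)
Lemma CGamma_shift_down (s : CC) (n : nat) :
  (forall k : Z, s <> RtoC (IZR k)) ->
  CGamma (s - RtoC (INR n)) * poch (1 - s) n * (- (1)) ^ n = CGamma s.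
Proof.
intros Hs; induction n as [|n IH].
- simpl; replace (s - 0) with s by ring; ring.
- rewrite <- IH.
  replace (s - RtoC (INR n)) with (s - RtoC (INR (S n)) + 1)
    by (rewrite RtoC_INR_S; ring).
  rewrite CGamma_succ.
  + rewrite poch_S, RtoC_INR_S; simpl Cpow; ring.
  + intros k K; apply (Hs (Z.of_nat (S n) - Z.of_nat k)%Z).
    rewrite minus_IZR, <- !INR_IZR_INZ, RtoC_minus.
    replace s with (s - RtoC (INR (S n)) + RtoC (INR (S n))) by ring.
    rewrite K; ring.
Qed.

(** The 2n factors from [a - n] to [a + n - 1] split in the middle; the lower half, reversed and
    negated, is [poch (1 - a) n]. Its sign cancels the one in [CGamma_shift_down]. *)
Lemma poch_centered (a : CC) (n : nat) :
  poch (a - RtoC (INR n)) (2 * n) = (- (1)) ^ n * poch (1 - a) n * poch a n.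
Proof.
induction n as [|n IH]; [simpl; ring|].
replace (2 * S n)%nat with (S (S (2 * n))) by lia.
rewrite poch_S_l.
replace (a - RtoC (INR (S n)) + 1) with (a - RtoC (INR n)) by (rewrite RtoC_INR_S; ring).
rewrite (poch_S _ (2 * n)), IH, !poch_S, mult_INR, RtoC_mult, RtoC_INR_S.
simpl (INR 2); replace (RtoC (1 + 1)) with (RtoC 2) by (f_equal; ring).
simpl Cpow; ring.
Qed.

Lemma sum_n_scal (c : CC) (u : nat -> CC) (n : nat) :
  sum_n (fun k => c * u k) n = c * sum_n u n.
Proof.
induction n as [|n IH]; [now rewrite !sum_O|].
rewrite !sum_n_S, IH; symmetry; apply Cmult_plus_distr_l.
Qed.

Lemma Csin_sub_PI2 (x : CC) : Csin (x - RtoC (PI / 2)) = - Ccos x.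
Proof.
assert (E : Cexp (Ci * RtoC (PI / 2)) = Ci).
{ replace (Ci * RtoC (PI / 2)) with (0%R, (PI / 2)%R)
    by (apply injective_projections; simpl; ring).
  apply injective_projections; unfold Cexp, Re, Im, fst, snd;
    rewrite exp_0, ?cos_PI2, ?sin_PI2; simpl; ring. }
assert (E' : Cexp (- (Ci * RtoC (PI / 2))) = - Ci) by (rewrite Cexp_opp, E; apply Ci_inv).
unfold Csin, Ccos.
replace (Ci * (x - RtoC (PI / 2))) with (Ci * x + - (Ci * RtoC (PI / 2))) by ring.
replace (- (Ci * x + - (Ci * RtoC (PI / 2)))) with (- (Ci * x) + Ci * RtoC (PI / 2)) by ring.
rewrite !Cexp_plus, E, E'.
field; apply Ci_nz.
Qed.

(** The exponent is [3/2 - x], and [2^(3/2) = 2 sqrt 2]. *)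
Lemma Cpowr_2_half_pow (x : CC) :
  Cexp ((1 - (x - RtoC (/ 2))) * RtoC (- ln 2)) = Cpowr 2 x / RtoC (2 * sqrt 2).
Proof.
assert (H2 : (0 < sqrt 2)%R) by (apply sqrt_lt_R0; lra).
replace ((1 - (x - RtoC (/ 2))) * RtoC (- ln 2))
  with (x * RtoC (ln 2) + - RtoC (ln 2 + / 2 * ln 2))
  by (rewrite RtoC_opp, RtoC_plus, RtoC_mult; ring).
rewrite Cexp_plus, Cexp_opp, Cexp_RtoC, exp_plus, exp_ln by lra.
change (exp (/ 2 * ln 2)) with (Rpower 2 (/ 2)); rewrite Rpower_sqrt by lra.
reflexivity.
Qed.

Theorem mainTheorem2 (w z : CC)
  (hw : forall n : nat, w <> - RtoC (INR n))
  (hz : forall n : nat, z <> - RtoC (INR n))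
  (hwz : forall k : Z, w + z - RtoC (/ 2) <> RtoC (IZR k)) :
  is_series
    (fun n : nat =>
       CGamma (w + z - RtoC (INR n) - RtoC (/ 2))
       / (RtoC (2 ^ n) * RtoC (INR (Factorial.fact n)))
       * poch (w - z - RtoC (INR n) + RtoC (/ 2)) (2 * n))
    (RtoC (/ sqrt (2 * PI)) * Cpowr 2 (w + z) * CGamma w * CGamma z
     * (- (Csin (RtoC PI * w) * Csin (RtoC PI * z)) / Ccos (RtoC PI * (w + z)))).
Proof.
set (s := w + z - RtoC (/ 2)) in *.
set (a := w - z + RtoC (/ 2)).
assert (Hs : forall k : nat, s <> - RtoC (INR k)).
{ intros k K; apply (hwz (- Z.of_nat k)%Z).
  now rewrite opp_IZR, <- INR_IZR_INZ, RtoC_opp. }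
assert (Hc : forall k : nat, 1 - s <> - RtoC (INR k)).
{ intros k K; apply (hwz (1 + Z.of_nat k)%Z).
  rewrite plus_IZR, <- INR_IZR_INZ, RtoC_plus.
  replace s with (1 - (1 - s)) by ring; rewrite K; ring. }
pose proof (bailey_sum a (1 - s) _ Hc (bailey_prod_Clim w z hw hz Hc)) as H.
fold s in H.
apply (Clim_scal (CGamma s)) in H.
apply Clim_is_series.
assert (HR := CGamma_reflection s Hs Hc).
assert (Esin : Csin (RtoC PI * s) = - Ccos (RtoC PI * (w + z))).
{ rewrite <- Csin_sub_PI2; f_equal; unfold s, Rdiv; rewrite RtoC_mult; ring. }
rewrite Esin in HR.
(* A zero of the cosine would make the reflection product 0 instead of 1. *)
assert (Hcos : Ccos (RtoC PI * (w + z)) <> 0).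
{ intros K; rewrite K in HR; apply C1_nz; rewrite <- HR; unfold Cdiv; ring. }
match type of H with Clim _ ?x => match goal with |- Clim _ ?y => replace y with x end end.
- revert H; apply Clim_ext; intros n; rewrite <- sum_n_scal.
  apply sum_n_ext; intros k.
  pose proof (CGamma_shift_down s k hwz) as Eg.
  pose proof (poch_centered a k) as Ep.
  replace (w + z - RtoC (INR k) - RtoC (/ 2)) with (s - RtoC (INR k)) by (unfold s; ring).
  replace (w - z - RtoC (INR k) + RtoC (/ 2)) with (a - RtoC (INR k)) by (unfold a; ring).
  rewrite Ep, <- Eg; unfold hyp_term.
  pose proof (poch_neq_0 _ k Hc) as Hp.
  pose proof (RtoC_fact_neq_0 k) as Hf; pose proof (RtoC_pow2_neq_0 k) as H2.
  (* The equality is typed in the carrier of a canonical structure; [field] needs it in [CC]. *)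
  match goal with |- ?x = ?y => change (@eq CC x y) end.
  field; auto.
- assert (HpiS : RtoC PI = RtoC (sqrt PI) * RtoC (sqrt PI))
    by (rewrite <- RtoC_mult, sqrt_sqrt; [reflexivity | left; apply PI_RGT_0]).
  assert (HS0 : RtoC (sqrt PI) <> 0)
    by (apply RtoC_neq_0, Rgt_not_eq, sqrt_lt_R0, PI_RGT_0).
  assert (H20 : RtoC (sqrt 2) <> 0) by (apply RtoC_neq_0, Rgt_not_eq, sqrt_lt_R0; lra).
  assert (H22 : RtoC 2 <> 0) by (apply RtoC_neq_0; lra).
  replace (Cexp ((1 - s) * RtoC (- ln 2))) with (Cpowr 2 (w + z) / RtoC (2 * sqrt 2))
    by (symmetry; apply Cpowr_2_half_pow).
  rewrite sqrt_mult by (try (left; apply PI_RGT_0); lra).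
  rewrite RtoC_inv, !RtoC_mult.
  2:{ apply Rgt_not_eq, Rmult_lt_0_compat; apply sqrt_lt_R0; [lra | apply PI_RGT_0]. }
  set (X := RtoC PI * z); set (Y := RtoC PI * w).
  assert (HG : CGamma s * CGamma (1 - s) = - (RtoC PI / Ccos (RtoC PI * (w + z)))).
  { transitivity (- (RtoC PI / Ccos (RtoC PI * (w + z)))
      * (- Ccos (RtoC PI * (w + z)) / RtoC PI * CGamma s * CGamma (1 - s))).
    - field; split; auto using RtoC_PI_neq_0.
    - rewrite HR; ring. }
  set (Z := Ccos (RtoC PI * (w + z))) in *.
  (* Once the two values of Gamma at [s] and [1 - s] stand together, the constants are [2 sqrt(pi) /
     pi^2 * pi / (2 sqrt 2) = 1 / sqrt(2 pi)]. *)
  transitivity (2 * RtoC (sqrt PI)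
    * (Csin X / RtoC PI * CGamma z * (Csin Y / RtoC PI * CGamma w))
    * (CGamma s * CGamma (1 - s)) * (Cpowr 2 (w + z) / (RtoC 2 * RtoC (sqrt 2)))); [ring|].
  rewrite HG, HpiS; field; auto.
Qed.
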